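(* Let $p,q\ge 1$ be integers, let $A_1,\dots,A_q,B_1,\dots,B_q$ be $p\times p$ real matrices (possibly with negative entries), and let $d\in\mathbb{R}^p$. Let $(N^{(t)})_{t\in\mathbb{Z}}$ be an i.i.d. sequence of $p$-dimensional count processes such that, for each $t$, every coordinate process $N^{(t)}_1,\dots,N^{(t)}_p$ is a homogeneous Poisson process on $[0,\infty)$ with intensity $1$ (the dependence between the $p$ coordinates being arbitrary). Consider the log-linear model $$Y_t=N^{(t)}_{\lambda_t},\qquad \lambda_t=\exp(\mu_t),\qquad \mu_t=d+\sum_{j=1}^q A_j\mu_{t-j}+\sum_{j=1}^q B_j\log(\mathbf{1}+Y_{t-j}),\qquad t\in\mathbb{Z}, \qquad (\ast)$$ where $\exp$ and $\log$ are applied componentwise and $\mathbf{1}=(1,\dots,1)'\in\mathbb{R}^p$. 1. Assume that $\rho\left(\sum_{i=1}^q(|A_i|_{vec}+|B_i|_{vec})\right)<1$. Then there exists a unique non-anticipative, stationary and integrable process $(Y_t)_{t\in\mathbb{Z}}$ solution of $(\ast)$, with $\mathbb{E}(|Y_t|_1)<\infty$. 2. Assume that $\left|\sum_{i=1}^q\left(|A_i|_{vec}+|B_i|_{vec}\right)\right|_\infty<1$. Then for this solution there exists $\delta>0$ such that $\mathbb{E}\left(\exp(\delta|Y_0|_1)\right)<\infty$ and $\mathbb{E}\left(\exp(\delta|\lambda_0|_1)\right)<\infty$.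
   Context: $\rho(\cdot)$ denotes the spectral radius of a square matrix. For a matrix $A$, $|A|_{vec}=(|A(i,j)|)_{i,j}$ is the matrix of absolute values of entries, and $|A|_\infty=\max_{i}\sum_{j}|A(i,j)|$. For $x\in\mathbb{R}^p$, $|x|_1=\sum_{i=1}^p|x_i|$. For $\lambda\in\mathbb{R}_+^p$, $N^{(t)}_\lambda=\left(N^{(t)}_{1,\lambda_1},\dots,N^{(t)}_{p,\lambda_p}\right)'$, i.e. the $i$-th Poisson process evaluated at time $\lambda_i$. A solution is a process $(Y_t,\mu_t)_{t\in\mathbb{Z}}$ with values in $\mathbb{N}^p\times\mathbb{R}^p$, defined on the probability space carrying $(N^{(t)})_{t\in\mathbb{Z}}$ and satisfying the equations almost surely for every $t$; it is stationary if $(Y_t,\mu_t)_{t\in\mathbb{Z}}$ is (strictly) stationary, non-anticipative if $(Y_t,\mu_t)$ is measurable with respect to $\sigma(N^{(s)}:s\le t)$ for every $t$, and integrable if $\mathbb{E}|Y_t|_1<\infty$. Uniqueness is up to almost sure equality. The condition in item 2 implies the condition in item 1 since $\rho(M)\le|M|_\infty$. *)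

(* Defs.v *)
(* MathComp / MathComp-Analysis *)
From HB Require Import structures.
From mathcomp Require Import all_boot all_order all_algebra complex.
From mathcomp Require Import all_classical all_reals all_analysis.
Set Implicit Arguments.
Unset Strict Implicit.
Unset Printing Implicit Defensive.
Import Order.TTheory GRing.Theory Num.Theory numFieldNormedType.Exports.
Local Open Scope classical_set_scope.
Local Open Scope ring_scope.

Definition abs_mx (R : realType) (p : nat) (M : 'M[R]_p) : 'M[R]_p :=
  map_mx (fun x : R => `|x|) M.

Definition mx_norm_inf (R : realType) (p : nat) (M : 'M[R]_p) : R :=
  \big[Num.max/0]_(i < p) \sum_(j < p) `|M i j|.

(* The eigenvalues are the complex ones; for p > 0 they form a nonempty finite
   set, so the supremum is a maximum. *)
Definition spectral_radius (R : realType) (p : nat) (M : 'M[R]_p) : R :=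
  sup [set Normc.normc z | z in
        [set z : R[i] | eigenvalue (map_mx (real_complex R) M) z]].

Definition norm1 (R : realType) (p : nat) (x : 'cV[R]_p) : R :=
  \sum_(i < p) `|x i 0|.

Section Processes.
Context {disp : measure_display} {T : measurableType disp}.

(* For the coordinate process on [I -> V] (see [same_law]) this is the product
   sigma-algebra. *)
Definition sigma_of (U I : Type) (dV : measure_display) (V : measurableType dV)
    (X : I -> U -> V) : set (set U) :=
  <<s \bigcup_i preimage_set_system [set: U] (X i) measurable >>.

Context {R : realType} (P : probability T R).

Definition same_law (I : Type) (dV : measure_display) (V : measurableType dV)
    (X X' : I -> T -> V) : Prop :=
  forall A : set (I -> V), sigma_of (fun i (x : I -> V) => x i) A ->
    P [set w | A (X ^~ w)] = P [set w | A (X' ^~ w)].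

Definition finite_mean (X : T -> R) : Prop := ('E_P[X] < +oo)%E.

Definition independent (I : choiceType) (F : I -> set (set T)) : Prop :=
  forall (J : seq I) (A : I -> set T), uniq J ->
    (forall i, i \in J -> F i (A i)) ->
    P (\bigcap_(i in [set` J]) A i) = (\prod_(i <- J) P (A i))%E.

(* [nondecr] makes the truncated subtraction of [nat] harmless in the
   increments; [rcont] is right-continuity for the discrete topology of [nat]. *)
Record poisson_process (N : {nonneg R} -> T -> nat) : Prop := PoissonProcess {
  measurable_count : forall s, measurable_fun [set: T] (N s);
  count0 : forall w, N 0%:nng w = 0%N;
  nondecr : forall w (s u : {nonneg R}), s%:num <= u%:num -> (N s w <= N u w)%N;
  rcont : forall w (s : {nonneg R}), exists2 e : R, 0 < e &
    forall u : {nonneg R}, s%:num <= u%:num < s%:num + e -> N u w = N s w;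
  indep_increments : forall s : nat -> {nonneg R},
    (forall k, (s k)%:num <= (s k.+1)%:num) ->
    independent (fun k : nat => preimage_set_system [set: T]
      (fun w => N (s k.+1) w - N (s k) w)%N measurable);
  poisson_increments : forall s u : {nonneg R}, s%:num < u%:num -> forall k,
    P [set w | (N u w - N s w)%N = k] = (poisson_pmf (u%:num - s%:num) k)%:E
}.

Context {p : nat}.

Definition iid_processes (N : int -> 'I_p -> {nonneg R} -> T -> nat) : Prop :=
  independent (fun t => sigma_of (uncurry (N t))) /\
  (forall s t, same_law (uncurry (N s)) (uncurry (N t))).

Definition iid_poisson (N : int -> 'I_p -> {nonneg R} -> T -> nat) : Prop :=
  iid_processes N /\ (forall t i, poisson_process (N t i)).

Definition past (N : int -> 'I_p -> {nonneg R} -> T -> nat) (t : int) :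
    set (set T) :=
  <<s \bigcup_(s in [set s : int | s <= t]) sigma_of (uncurry (N s)) >>.

Definition count_at (N : 'I_p -> {nonneg R} -> T -> nat) (l : 'cV[{nonneg R}]_p)
    (w : T) : 'cV[nat]_p := \col_i N i (l i 0) w.

Definition exp_vec (x : 'cV[R]_p) : 'cV[{nonneg R}]_p :=
  map_mx (fun y : R => (expR y)%:nng) x.

Definition log1_vec (y : 'cV[nat]_p) : 'cV[R]_p :=
  map_mx (fun n : nat => ln (1 + n%:R)) y.

Definition real_vec (y : 'cV[nat]_p) : 'cV[R]_p :=
  map_mx (fun n : nat => n%:R) y.

Definition intensity_norm1 (l : 'cV[{nonneg R}]_p) : R :=
  norm1 (map_mx (fun x : {nonneg R} => x%:num) l).

(* [A j] is the matrix of lag [j + 1]. *)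
Definition log_linear_solution (q : nat) (A B : 'I_q -> 'M[R]_p) (d : 'cV[R]_p)
    (N : int -> 'I_p -> {nonneg R} -> T -> nat)
    (Y : int -> T -> 'cV[nat]_p) (mu : int -> T -> 'cV[R]_p) : Prop :=
  forall t : int, {ae P, forall w,
    Y t w = count_at (N t) (exp_vec (mu t w)) w /\
    mu t w = d + \sum_(j < q) A j *m mu (t - j.+1%:Z) w
               + \sum_(j < q) B j *m log1_vec (Y (t - j.+1%:Z) w)}.

(* The (N^p x R^p)-valued process (Y, mu), presented as a family of
   (N x R)-valued variables indexed by time and coordinate. *)
Definition joint (Y : int -> T -> 'cV[nat]_p) (mu : int -> T -> 'cV[R]_p) :
    int * 'I_p -> T -> nat * measurableTypeR R :=
  fun k w => (Y k.1 w k.2 0, mu k.1 w k.2 0).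

Definition stationary (Y : int -> T -> 'cV[nat]_p)
    (mu : int -> T -> 'cV[R]_p) : Prop :=
  forall h : int,
    same_law (fun k => joint Y mu (k.1 + h, k.2)) (joint Y mu).

Definition non_anticipative (N : int -> 'I_p -> {nonneg R} -> T -> nat)
    (Y : int -> T -> 'cV[nat]_p) (mu : int -> T -> 'cV[R]_p) : Prop :=
  forall t : int, sigma_of (fun i => joint Y mu (t, i)) `<=` past N t.

Definition integrable_counts (Y : int -> T -> 'cV[nat]_p) : Prop :=
  forall t : int, finite_mean (fun w => norm1 (real_vec (Y t w))).

Definition regular_solution (q : nat) (A B : 'I_q -> 'M[R]_p) (d : 'cV[R]_p)
    (N : int -> 'I_p -> {nonneg R} -> T -> nat)
    (Y : int -> T -> 'cV[nat]_p) (mu : int -> T -> 'cV[R]_p) : Prop :=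
  [/\ log_linear_solution A B d N Y mu, stationary Y mu,
      non_anticipative N Y mu & integrable_counts Y].

End Processes.

(* Main.v *)
(* Write G for the sum over the lags j of |A_j| + |B_j|. If the spectral radius of G is less
   than 1 there are weights w > 0 with G w <= c w, c < 1: otherwise let s0 >= 1 be the infimum
   of the s admitting some w > 0 with G w < s w; the resolvent at s0 is a limit of nonnegative
   ones, which shows that this s0 is attained and can be decreased.

   For x <= y a unit Poisson process N satisfies
     E[log(1 + N(e^y)) - log(1 + N(e^x))] <= y - x,
   by concavity of the logarithm and E[1 / (1 + N(a))] <= 1 / a. Since mu_t depends only on the
   past, it can be frozen in these expectations, so one application of the recursion contracts
   by c the L1 distance, weighted by w, between two predictable processes. The Picard iterates
   started from 0 therefore converge almost surely and in L1, and are functionals of the noise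
   that commute with time shifts, which gives stationarity. Moments of the form
   sup_t E[Psi(|mu_t| / w)] stay bounded along the iterates as soon as Psi(D + c v) is
   negligible with respect to Phi(v), where Phi bounds what one Poisson draw does to Psi:
   Psi = Phi = exp gives integrability of the counts, and with w = 1, Psi(v) = exp(e^v),
   Phi(v) = exp(e^v / 8) gives the exponential moments.

   For uniqueness, a stationary solution with integrable counts has E|mu_t| bounded: discounting
   lag j by g^j with c <= g^q turns the recursion into a one-step contraction driven by the
   counts, whose initial term vanishes in probability by stationarity. The L1 contraction then
   applies to the difference of two solutions. *)
Require Import Defs.
From HB Require Import structures.
From mathcomp Require Import all_boot all_order all_algebra complex.
From mathcomp Require Import all_classical all_reals all_analysis.
From mathcomp Require Import measurable_realfun.
From mathcomp Require Import ring lra.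
Set Implicit Arguments.
Unset Strict Implicit.
Unset Printing Implicit Defensive.
Import Order.TTheory GRing.Theory Num.Theory numFieldNormedType.Exports.
Local Open Scope classical_set_scope.
Local Open Scope ring_scope.

(** * Weights contracted by the coefficient matrices *)

(** A Poisson path is read at the time [expR (U w)], a random real number, whereas independence
    directly allows freezing only variables with countably many values. Times are therefore rounded
    to a grid, upwards because the paths are right-continuous, and the estimate is recovered by
    Fatou's lemma. As a rounded time is slightly too large, each frozen estimate is required on a
    window [[U, U + eps]]: [eps] is arbitrarily small in the L1 contraction, and [eps = 1] costs a
    constant factor in the moment bounds. The exponents [1 / w k] separate the two items. With
    [Psi = exp], one draw involves the mean of the power [1 / w k] of [1 + n], finite for every
    weight. With the double exponential it involves an exponential moment of that power, which is
    infinite for a Poisson variable as soon as [w k < 1]; hence the weights 1, which the bound on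
    the row sums permits. *)

Section subinvariant.
Variables (R : realType) (p : nat) (G : 'M[R]_p).
Hypothesis G0 : forall i j, 0 <= G i j.

(* Minimum principle: compare [x] with [m w], where [m] is the least ratio [x i / w i]. *)
Lemma supersolution_ge0 (s : R) (w x : 'cV[R]_p) :
  (forall i, 0 < w i 0) -> (forall i, (G *m w) i 0 < s * w i 0) ->
  (forall i, (G *m x) i 0 <= s * x i 0) -> forall i, 0 <= x i 0.
Proof.
move=> w0 Gw Gx i1.
have [i _ imin] := @arg_minP _ _ _ i1 predT (fun i => x i 0 / w i 0) isT.
set m := x i 0 / w i 0 in imin.
have mw k : m * w k 0 <= x k 0 by rewrite -ler_pdivlMr ?imin.
have [m0|m0] := leP 0 m.
  by apply: le_trans (mw i1); rewrite mulr_ge0 // ltW.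
have xi : x i 0 = m * w i 0 by rewrite /m divfK // gt_eqF.
have H1 : m * (G *m w) i 0 <= (G *m x) i 0.
  rewrite !mxE mulr_sumr ler_sum // => j _.
  by rewrite mulrCA ler_wpM2l.
have H2 : m * (s * w i 0) < m * (G *m w) i 0 by rewrite ltr_nM2l.
have := lt_le_trans H2 (le_trans H1 (Gx i)).
by rewrite xi mulrCA ltxx.
Qed.

Lemma subinvariant_vector :
  (forall s : R, 1 <= s -> \det (s%:M - G) != 0) ->
  exists2 w : 'cV[R]_p, forall i, 0 < w i 0 &
    forall i, (G *m w) i 0 < w i 0.
Proof.
move=> detN0.
pose S := [set s : R | 1 <= s /\ exists2 w : 'cV[R]_p, forall i, 0 < w i 0 &
    forall i, (G *m w) i 0 < s * w i 0].
have rowle i : \sum_j G i j <= \sum_i \sum_j G i j.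
  by rewrite [leRHS](bigD1 i) //= lerDl sumr_ge0 // => k _; rewrite sumr_ge0.
have SS : S (1 + \sum_i \sum_j G i j).
  split; first by rewrite lerDl sumr_ge0 // => i _; rewrite sumr_ge0.
  exists (const_mx 1) => i; first by rewrite mxE.
  rewrite !mxE mulr1.
  under eq_bigr do rewrite mxE mulr1.
  by rewrite (le_lt_trans (rowle i)) // ltrDr.
have lbS : lbound S 1 by move=> s [].
have hS : has_inf S by split; [exists (1 + \sum_i \sum_j G i j)|exists 1].
set s0 := inf S.
have s01 : 1 <= s0 by apply: lb_le_inf => //; case: hS.
pose one : 'cV[R]_p := const_mx 1.
(* The resolvent exists at [s0] itself, although [s0] is not yet known to belong to [S]. *)
have unit0 : s0%:M - G \in unitmx by rewrite unitmxE unitfE detN0.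
pose K := invmx (s0%:M - G).
pose x0 := K *m one.
have x0E : s0 *: x0 = one + G *m x0.
  apply/eqP; rewrite -subr_eq -mul_scalar_mx -mulmxBl.
  by rewrite /x0 mulmxA mulmxV // mul1mx.
pose kap := \sum_i \sum_j `|K i j|.
pose xi := \sum_i `|x0 i 0|.
have kap0 : 0 <= kap by rewrite sumr_ge0 // => i _; rewrite sumr_ge0.
have xi0 : 0 <= xi by rewrite sumr_ge0.
(* Take [s] in [S] within [del] of [s0]: its resolvent vector [x] is nonnegative by the minimum
   principle, and [x0 = x + r K x]. The first bound in [del] gives [r * kap <= 1/2], hence
   [X <= 2 * xi]; the second then gives [r * kap * 2 * xi <= e]. *)
have near0 i (e : R) : 0 < e -> - e <= x0 i 0.
  move=> e0.
  pose del := Num.min (2 * kap + 1)^-1 (e / (2 * kap * xi + 1)).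
  have kx0 : 0 <= 2 * kap * xi by rewrite !mulr_ge0.
  have del0 : 0 < del by rewrite lt_min invr_gt0 divr_gt0 // ltr_wpDl // mulr_ge0.
  have [s [s1 [w w0 Gw]] sdel] := inf_adherent del0 hS.
  have s0s : s0 <= s by apply: ge_inf; [case: hS|split => //; exists w].
  set r := s - s0.
  have r0 : 0 <= r by rewrite subr_ge0.
  have rdel : r < del by rewrite ltrBlDl.
  have unit1 : s%:M - G \in unitmx by rewrite unitmxE unitfE detN0.
  pose x := invmx (s%:M - G) *m one.
  have xE : s *: x = one + G *m x.
    apply/eqP; rewrite -subr_eq -mul_scalar_mx -mulmxBl.
    by rewrite /x mulmxA mulmxV // mul1mx.
  have xge0 : forall i, 0 <= x i 0.
    apply: (supersolution_ge0 w0 Gw) => k.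
    by have /matrixP/(_ k 0) := xE; rewrite !mxE => ->; rewrite lerDr.
  have xx0 : x0 = x + r *: (K *m x).
    rewrite /x0; have -> : one = (s0%:M - G) *m x + r *: x.
      rewrite mulmxBl mul_scalar_mx addrAC /r -scalerDl [_ + (s - _)]addrC subrK.
      by rewrite xE addrK.
    by rewrite mulmxDr mulmxA mulVmx // mul1mx -scalemxAr.
  pose X := \big[Num.max/0]_k x k 0.
  have xX k : x k 0 <= X by exact: (le_bigmax 0 (fun k => x k 0)).
  have X0 : 0 <= X by rewrite /X; apply: bigmax_ge_id.
  have KX k : `|(K *m x) k 0| <= kap * X.
    rewrite mxE (le_trans (ler_norm_sum _ _ _)) //.
    apply: (@le_trans _ _ (\sum_j `|K k j| * X)).
      apply: ler_sum => j _; rewrite normrM ler_wpM2l //.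
      by rewrite ger0_norm.
    rewrite -mulr_suml ler_wpM2r // /kap [leRHS](bigD1 k) //= lerDl.
    by rewrite sumr_ge0 // => l _; rewrite sumr_ge0.
  have X2 : X <= 2 * xi.
    have rk : r * kap <= 2^-1.
      have : r < (2 * kap + 1)^-1 by apply: lt_le_trans rdel _; rewrite ge_min lexx.
      rewrite -[_^-1]mul1r ltr_pdivlMr; last by rewrite ltr_wpDl // mulr_ge0.
      nra.
    have XX : X <= xi + 2^-1 * X.
      rewrite /X; apply: bigmax_le; first by rewrite -/X addr_ge0 // mulr_ge0.
      move=> k _; rewrite -/X.
      have -> : x k 0 = x0 k 0 - r * (K *m x) k 0.
        by rewrite xx0 !mxE addrK.
      apply: lerD.
        by rewrite (le_trans (ler_norm _)) // /xi (bigD1 k) //= lerDl sumr_ge0.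
      have Kk := KX k.
      apply: (@le_trans _ _ (r * `|(K *m x) k 0|)).
        by rewrite -mulrN ler_wpM2l // ler_normr lexx orbT.
      apply: (@le_trans _ _ (r * (kap * X))); first by rewrite ler_wpM2l.
      by rewrite mulrA ler_wpM2r.
    lra.
  rewrite xx0 mxE.
  have -> : (r *: (K *m x)) i 0 = r * (K *m x) i 0 by rewrite mxE.
  apply: (@le_trans _ _ (r * (K *m x) i 0)); last by rewrite lerDr.
  rewrite lerNl -mulrN.
  apply: (@le_trans _ _ (r * `|(K *m x) i 0|)).
    by rewrite ler_wpM2l // ler_normr lexx orbT.
  apply: (@le_trans _ _ (r * (kap * (2 * xi)))).
    by rewrite ler_wpM2l // (le_trans (KX i)) // ler_wpM2l.
  have : r < e / (2 * kap * xi + 1).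
    by apply: lt_le_trans rdel _; rewrite ge_min lexx orbT.
  rewrite ltr_pdivlMr; last by rewrite ltr_wpDl // !mulr_ge0.
  nra.
have x0ge0 i : 0 <= x0 i 0.
  rewrite leNgt; apply/negP => xl.
  have := near0 i (- x0 i 0 / 2); rewrite divr_gt0 ?oppr_gt0 // => /(_ isT).
  lra.
have Gx0 i : (G *m x0) i 0 = s0 * x0 i 0 - 1.
  by have /matrixP/(_ i 0) := x0E; rewrite !mxE => ->; rewrite [1 + _]addrC addrK.
have x0gt0 i : 0 < x0 i 0.
  rewrite lt_neqAle x0ge0 andbT; apply/eqP => xi00.
  have : 0 <= (G *m x0) i 0 by rewrite mxE sumr_ge0 // => j _; rewrite mulr_ge0.
  by rewrite Gx0 -xi00 mulr0 sub0r lerNr oppr0 ler10.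
suff s0e : s0 = 1.
  by exists x0 => // i; rewrite Gx0 s0e mul1r ltrBlDr ltrDl.
apply/eqP; rewrite eq_le s01 andbT leNgt; apply/negP => s0gt.
(* Since [G x0 = s0 x0 - 1] and every entry of [x0] is below [xi + 1], the vector [x0] still has
   slack at [s0 - 1 / (xi + 1)], which contradicts the infimum if [s0 > 1]. *)
pose s1 := Num.max 1 (s0 - (xi + 1)^-1).
have x1 : 0 < xi + 1 by rewrite ltr_wpDl.
have : s0 <= s1.
  apply: ge_inf; [by case: hS|split]; first by rewrite le_max lexx.
  exists x0 => // i; rewrite Gx0.
  apply: (@lt_le_trans _ _ ((s0 - (xi + 1)^-1) * x0 i 0)); last first.
    by rewrite ler_wpM2r // le_max lexx orbT.
  rewrite mulrBl ltrD2l ltrN2 mulrC ltr_pdivrMr // mul1r.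
  rewrite (@le_lt_trans _ _ xi) ?ltrDl // (le_trans (ler_norm _)) //.
  by rewrite /xi (bigD1 i) //= lerDl sumr_ge0.
by rewrite le_max leNgt s0gt /= lerBrDr gerDl leNgt invr_gt0 x1.
Qed.

End subinvariant.

Lemma spectral_radius_det (R : realType) (p : nat) (G : 'M[R]_p) :
  spectral_radius G < 1 -> forall s : R, 1 <= s -> \det (s%:M - G) != 0.
Proof.
move=> rG s s1; apply/negP => /det0P [v v0 vG].
set Gc := map_mx (real_complex R) G.
set E := [set Normc.normc z | z in [set z : R[i] | eigenvalue Gc z]].
have Es : E s.
  exists (real_complex R s).
    rewrite /=; apply/eigenvalueP; exists (map_mx (real_complex R) v); last first.
      by rewrite map_mx_eq0.
    rewrite -map_mxM; have /eqP := vG.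
    by rewrite mulmxBr mul_mx_scalar subr_eq0 => /eqP <-; rewrite map_mxZ.
  by rewrite /= expr0n /= addr0 sqrtr_sqr ger0_norm // (le_trans ler01).
(* [sup] dominates its elements only for a bounded set: eigenvalues are roots of the characteristic
   polynomial, so each modulus is at most the sum of the moduli of the roots. *)
have uE : has_ubound E.
  have [rs rsE] := closed_field_poly_normal (char_poly Gc).
  exists (\sum_(z <- rs) Normc.normc z) => _ [z zE <-].
  have {zE} : eigenvalue Gc z by [].
  rewrite eigenvalue_root_char rsE (monicP (char_poly_monic _)) scale1r.
  rewrite root_prod_XsubC => zrs; rewrite (big_rem z) //= lerDl.
  by rewrite sumr_ge0 // => -[a b] _ /=; rewrite sqrtr_ge0.
have := ub_le_sup uE Es; rewrite leNgt => /negP; apply.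
exact: lt_le_trans rG s1.
Qed.

(* Normalising [w <= 1] makes all the exponents [1 / w i] at least [1]. *)
Lemma contraction_weights (R : realType) (p : nat) (G : 'M[R]_p) :
  (forall i j, 0 <= G i j) -> spectral_radius G < 1 ->
  exists (w : 'I_p -> R) (c : R), [/\ 0 < c < 1, forall i, 0 < w i <= 1 &
    forall i, \sum_j G i j * w j <= c * w i].
Proof.
move=> G0 rG.
have [w w0 Gw] := subinvariant_vector G0 (spectral_radius_det rG).
pose W := 1 + \sum_i w i 0.
have W0 : 0 < W by rewrite ltr_pwDl // sumr_ge0 // => i _; rewrite ltW.
have GwE i : (G *m w) i 0 = \sum_j G i j * w j 0 by rewrite mxE.
(* Starting the maximum at 1/2 keeps [c] positive even when [G] vanishes. *)
pose c := \big[Num.max/2^-1]_i ((G *m w) i 0 / w i 0).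
have c0 : 2^-1 <= c by rewrite /c bigmax_ge_id.
exists (fun i => w i 0 / W), c; split => [|i|i].
- apply/andP; split; first by rewrite (lt_le_trans _ c0).
  rewrite /c; apply: bigmax_lt; first by rewrite invf_lt1 ?ltr1n.
  by move=> i _; rewrite ltr_pdivrMr // mul1r.
- rewrite divr_gt0 // ler_pdivrMr // mul1r /W (bigD1 i) //=.
  by rewrite addrCA lerDl addr_ge0 // sumr_ge0 // => j _; rewrite ltW.
- under eq_bigr do rewrite mulrA.
  rewrite -mulr_suml -GwE mulrA ler_wpM2r ?invr_ge0 ?(ltW W0) //.
  rewrite -ler_pdivrMr //; exact: (le_bigmax _ (fun i => (G *m w) i 0 / w i 0)).
Qed.

(** * Independence and freezing *)

Section cylinders.
Variables (U : Type) (I : choiceType) (F : I -> set (set U)) (S : set I).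
Hypothesis FI : forall i, S i -> setI_closed (F i).
Hypothesis FT : forall i, S i -> F i [set: U].

Definition cylinders : set (set U) :=
  [set C | exists (J : seq I) (A : I -> set U),
    [/\ [set` J] `<=` S, (forall i, S i -> F i (A i)) &
        C = \bigcap_(i in [set` J]) A i]].

Lemma cylindersT : cylinders [set: U].
Proof.
exists [::], (fun=> setT); split => //.
by apply/seteqP; split => // x _ i.
Qed.

Lemma sub_cylinders : \bigcup_(i in S) F i `<=` cylinders.
Proof.
move=> A [i Si FA]; exists [:: i], (fun j => if j == i then A else setT).
split=> [j|j Sj|]; first by rewrite /= inE => /eqP ->.
  by case: eqP => [->|_] //; exact: FT.
apply/seteqP; split=> [x Ax j|x /(_ i)]; first by rewrite /= inE => ->.
by rewrite /= inE eqxx; exact.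
Qed.

Lemma cylinders_setI_closed : setI_closed cylinders.
Proof.
move=> _ _ [J1 [A1 [J1S FA1 ->]]] [J2 [A2 [J2S FA2 ->]]].
exists (J1 ++ J2), (fun i => (if i \in J1 then A1 i else setT) `&`
                             (if i \in J2 then A2 i else setT)).
split=> [i|i Si|].
- by rewrite /= mem_cat => /orP[/J1S|/J2S].
- by apply: FI => //; case: ifP => _; [exact: FA1|exact: FT|exact: FA2|exact: FT].
- apply/seteqP; split=> [x [x1 x2] i|x x12].
    by rewrite /= => _; split; case: ifPn => // iJ; [exact: x1|exact: x2].
  by split=> i iJ; have := x12 i; rewrite /= mem_cat iJ ?orbT => /(_ isT) [].
Qed.

End cylinders.

(** Finite intersections form a pi-system, so Dynkin's theorem applies. It serves twice: for the
    independence of the past from the present, and for the invariance of the noise under time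
    shifts. *)
Lemma cylinders_unique d (T : measurableType d) (R : realType) (I : choiceType)
    (F : I -> set (set T)) (S : set I) (m1 m2 : {measure set T -> \bar R}) :
  (forall i, S i -> setI_closed (F i)) -> (forall i, S i -> F i setT) ->
  (forall i, S i -> F i `<=` measurable) ->
  (m1 setT < +oo)%E ->
  (forall C, cylinders F S C -> m1 C = m2 C) ->
  forall A, <<s \bigcup_(i in S) F i >> A -> m1 A = m2 A.
Proof.
move=> FI FT Fm m1T m12 A sA.
apply: (@g_sigma_algebra_measure_unique _ _ _ (cylinders F S) _ (fun=> setT)) => //.
- move=> _ [J [B [JS FB ->]]].
  have -> : \bigcap_(i in [set` J]) B i =
      \bigcap_(i in [set` J]) (if i \in J then B i else setT).
    by apply: eq_bigcapr => i /= ->.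
  apply: fin_bigcap_measurable => // i iJ.
  case: ifPn => // _; apply: (Fm i); [exact: JS|apply: FB; exact: JS].
- by move=> _; exact: cylindersT.
- by apply/seteqP; split => // x _; exists 0%N.
- exact: cylinders_setI_closed.
- exact: (sub_sigma_algebra2 (sub_cylinders FT)) sA.
Qed.

Lemma integral_cst_prob (R : realType) d (T : measurableType d) (P : probability T R) (k : R) :
  (\int[P]_x (cst k%:E) x = k%:E)%E.
Proof.
by rewrite (integral_cst P measurableT k%:E) [X in (_ * X)%E]probability_setT mule1.
Qed.

Section independence.
Context d (T : measurableType d) (R : realType) (P : probability T R).

Definition indep2 (F G : set (set T)) :=
  forall A B, F A -> G B -> P (A `&` B) = (P A * P B)%E.

(** For fixed [B], both sides are finite measures in [A]: the restriction of [P] to [B], and [P]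
    scaled by [P B]. Independence makes them agree on cylinders. *)
Lemma independent_generated (I : choiceType) (F : I -> set (set T))
    (S : set I) (t : I) :
  independent P F -> (forall i, setI_closed (F i)) -> (forall i, F i setT) ->
  (forall i, F i `<=` measurable) -> ~ S t ->
  indep2 <<s \bigcup_(i in S) F i >> (F t).
Proof.
move=> indF FI FT Fm St A B FA FB.
have mB : measurable B by exact: Fm FB.
have B0 : 0 <= fine (P B) by exact: fine_ge0.
have PBfin : P B \is a fin_num by exact: fin_num_measure.
rewrite -[P (A `&` B)]/(mrestr P mB A) [RHS]muleC -[P B]fineK //.
rewrite -[RHS]/(mscale (NngNum B0) P A).
apply: (@cylinders_unique _ _ _ _ F S) => //.
  by rewrite /= /mrestr setTI -ge0_fin_numE.
move=> _ [J [C [JS FC ->]]].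
rewrite /= /mrestr /mscale /= fineK // muleC.
(* [independent] wants a list without repetition: [undup J] supplies it, and [t] can be added
   because it lies outside [S]. *)
pose D i := if i == t then B else C i.
have tJ : t \notin undup J by rewrite mem_undup; apply/negP => /JS.
have DJ i : i \in undup J -> D i = C i.
  by move=> iJ; rewrite /D; case: eqP => // it; rewrite it (negbTE tJ) in iJ.
have -> : \bigcap_(i in [set` J]) C i `&` B = \bigcap_(i in [set` t :: undup J]) D i.
  apply/seteqP; split=> [x [xC xB] i|x xD].
    rewrite /= inE /D; case: eqP => //= _; rewrite mem_undup; exact: xC.
  split=> [i iJ|]; last by have := xD t; rewrite /= inE eqxx /D eqxx; exact.
  have iJ' : i \in undup J by rewrite mem_undup.
  by have := xD i; rewrite /= inE iJ' orbT DJ //; exact.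
have -> : \bigcap_(i in [set` J]) C i = \bigcap_(i in [set` undup J]) D i.
  apply/seteqP; split=> x xC i iJ; first by rewrite DJ //; apply: xC; rewrite /= -mem_undup.
  by have := xC i; rewrite /= mem_undup => /(_ iJ); rewrite DJ ?mem_undup.
have FD i : i \in t :: undup J -> F i (D i).
  rewrite /D inE; case: eqP => [->|_] //=; rewrite mem_undup => /JS; exact: FC.
rewrite (indF (t :: undup J) D) //; last by rewrite /= tJ undup_uniq.
rewrite (indF (undup J) D) ?undup_uniq //; last first.
  by move=> i iJ; apply: FD; rewrite inE iJ orbT.
by rewrite big_cons /D eqxx muleC.
Qed.

Lemma ge0_integral_mrestr (A : set T) (mA : measurable A) (f : T -> \bar R) :
  measurable_fun setT f -> (forall x, 0 <= f x)%E ->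
  (\int[mrestr P mA]_x f x = \int[P]_(x in A) f x)%E.
Proof.
move=> mf f0; rewrite -(setUv A) ge0_integral_setU //=; first last.
- by apply/disj_setPS => x [].
- by rewrite setUv.
- exact: measurableC.
rewrite [X in (_ + X)%E](_ : _ = 0%E) ?adde0; last first.
  rewrite (eq_measure_integral mzero) ?integral_measure_zero // => B mB BA.
  by rewrite /= /mrestr (_ : B `&` A = set0) ?measure0 //; apply/seteqP; split => x // [/BA].
by apply: eq_measure_integral => B mB /setIidPl BA; rewrite /= /mrestr BA.
Qed.

Lemma indep_integral (F G : set (set T)) (A : set T) (f : T -> \bar R) :
  indep2 F G -> measurable A -> F A -> measurable_fun setT f ->
  (forall x, 0 <= f x)%E -> (forall B, measurable B -> G (f @^-1` B)) ->
  (\int[P]_(x in A) f x = P A * \int[P]_x f x)%E.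
Proof.
move=> FG mA FA mf f0 Gf.
have A0 : 0 <= fine (P A) by exact: fine_ge0.
have PA : P A \is a fin_num by exact: fin_num_measure.
rewrite -(ge0_integral_mrestr mA mf f0) -[in RHS](fineK PA).
(* After transport by [f] the integrand must be nonnegative on all of [\bar R], so the absolute
   value replaces the identity, from which it does not differ on the values of [f]. *)
have mid : measurable_fun [set: \bar R] (fun y : \bar R => `|y|%E).
  exact: measurableT_comp.
have fE : (fun x => f x) = (fun y => `|y|%E) \o f.
  by apply/funext => x /=; rewrite gee0_abs.
rewrite [in LHS]fE [in RHS]fE -[setT]/(f @^-1` setT).
rewrite -!ge0_integral_pushforward //.
rewrite -(@ge0_integral_mscale _ _ _ _ setT _ (NngNum A0)) //.
apply: eq_measure_integral => B mB _.
rewrite /= /pushforward /mrestr /mscale /= /pushforward fineK // setIC.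
by apply: FG => //; exact: Gf.
Qed.

(** Split the space according to the value of [c]. On [c = k] the integral of [Phi k] factors by
    independence, and there [H] dominates the full integral of [Phi k]. *)
Lemma freeze (F G : set (set T)) (c : T -> nat) (Phi : nat -> T -> \bar R)
    (H : T -> \bar R) :
  indep2 F G -> F `<=` measurable ->
  (forall k, F (c @^-1` [set k])) ->
  (forall k, measurable_fun setT (Phi k)) ->
  (forall k x, 0 <= Phi k x)%E -> (forall k B, measurable B -> G (Phi k @^-1` B)) ->
  measurable_fun setT H -> (forall x, 0 <= H x)%E ->
  (forall x, \int[P]_y Phi (c x) y <= H x)%E ->
  measurable_fun setT (fun x => Phi (c x) x) /\
  (\int[P]_x Phi (c x) x <= \int[P]_x H x)%E.
Proof.
move=> FG Fm Fc mPhi Phi0 GPhi mH H0 PhiH.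
have mc k : measurable (c @^-1` [set k]) by exact: Fm.
have cT : \bigcup_k (c @^-1` [set k]) = setT.
  by apply/seteqP; split => // x _; exists (c x).
have tc : trivIset setT (fun k => c @^-1` [set k]).
  by apply/trivIsetP => i j _ _ ij; apply/seteqP; split => x //= [-> /eqP]; rewrite (negbTE ij).
have mPc : measurable_fun setT (fun x => Phi (c x) x).
  rewrite -cT; apply/measurable_fun_bigcup => // k.
  apply: (eq_measurable_fun (Phi k)); last exact: measurable_funTS.
  by move=> x; rewrite inE /= => ->.
split => //.
rewrite -cT !ge0_integral_bigcup ?cT //.
apply: lee_nneseries => [k _ _|k _]; first by apply: integral_ge0 => x _.
have -> : (\int[P]_(x in c @^-1` [set k]) Phi (c x) x =
           \int[P]_(x in c @^-1` [set k]) Phi k x)%E.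
  by apply: eq_integral => x; rewrite inE /= => ->.
rewrite (indep_integral FG (mc k) (Fc k) (mPhi k) (Phi0 k) (GPhi k)) muleC.
have I0 : (0 <= \int[P]_x Phi k x)%E by exact: integral_ge0.
rewrite -integral_cst //; apply: ge0_le_integral => //.
- exact: measurable_funTS.
- by move=> x /= <-.
Qed.

End independence.

Section measurability.
Context d (T : measurableType d) d' (V : measurableType d').

Lemma measurable_fun_select (c : T -> nat) (Phi : nat -> T -> V) :
  measurable_fun setT c -> (forall k, measurable_fun setT (Phi k)) ->
  measurable_fun setT (fun x => Phi (c x) x).
Proof.
move=> mc mPhi _ B mB; rewrite setTI.
rewrite (_ : _ @^-1` B = \bigcup_k (c @^-1` [set k] `&` Phi k @^-1` B)).
  apply: bigcup_measurable => k _; apply: measurableI.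
    by rewrite -[X in measurable X]setTI; exact: mc.
  by rewrite -[X in measurable X]setTI; exact: mPhi.
by apply/seteqP; split=> [x xB|x [k _ [/= -> //]]]; exists (c x).
Qed.

(** Eventual equality, unlike convergence, needs no topology on [V]; integer-valued right-continuous
    paths provide it. *)
Lemma measurable_fun_eventually (f_ : nat -> T -> V) (f : T -> V) :
  (forall n, measurable_fun setT (f_ n)) ->
  (forall x, exists m, forall n, (m <= n)%N -> f_ n x = f x) ->
  measurable_fun setT f.
Proof.
move=> mf ef _ B mB; rewrite setTI.
rewrite (_ : f @^-1` B = \bigcup_m \bigcap_(n in [set n | (m <= n)%N]) (f_ n @^-1` B)).
  apply: bigcup_measurable => m _; apply: bigcap_measurable; first by exists m => /=.
  by move=> n _; rewrite -[X in measurable X]setTI; exact: mf.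
apply/seteqP; split=> [x xB|x [m _ mB']] /=; have [m0 em0] := ef x.
  by exists m0 => // n /= /em0; rewrite /preimage /= => ->.
rewrite /preimage /= -(em0 (maxn m m0)) ?leq_maxr //.
by apply: mB'; rewrite /= leq_maxl.
Qed.

Lemma measurable_fun_nat2 (f : nat -> nat -> V) (a b : T -> nat) :
  measurable_fun setT a -> measurable_fun setT b ->
  measurable_fun setT (fun x => f (a x) (b x)).
Proof.
move=> ma mb; apply: (@measurable_fun_select a (fun i x => f i (b x))) => // i.
by apply: (@measurable_fun_select b (fun j x => f i j)) => // j; exact: measurable_cst.
Qed.

End measurability.

Lemma measurable_fun_g_sigma d (T : measurableType d) (G : set (set T)) d'
    (V : measurableType d') (f : T -> V) :
  measurable_fun [set: g_sigma_algebraType G] f <->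
  (forall B, measurable B -> <<s G >> (f @^-1` B)).
Proof.
split=> [mf B mB|fB _ B mB]; last by rewrite setTI; exact: fB.
by rewrite -[X in <<s G >> X]setTI; exact: mf.
Qed.

Lemma measurable_fun_sub_sigma d (T : measurableType d) (G : set (set T)) d'
    (V : measurableType d') (f : T -> V) :
  <<s G >> `<=` measurable ->
  measurable_fun [set: g_sigma_algebraType G] f -> measurable_fun [set: T] f.
Proof.
by move=> Gm /measurable_fun_g_sigma fB _ B mB; rewrite setTI; apply: Gm; exact: fB.
Qed.

(** * Approximation of random times from the right *)

Section grid.
Variable R : realType.

(** The index [j] names the cell starting at [j / (n + 1)]; the value is its right end, so that
    rounding always moves strictly to the right. *)
Definition grid (n : nat) (j : int) : R := (j + 1)%:~R / n.+1%:R.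

Definition round_up (n : nat) (x : R) : R := grid n (Num.floor (n.+1%:R * x)).

Lemma round_up_bounds n x : x < round_up n x <= x + n.+1%:R^-1.
Proof.
rewrite /round_up /grid; have n0 : 0 < n.+1%:R :> R by rewrite ltr0n.
have /andP[h1 h2] := floor_itv (n.+1%:R * x).
apply/andP; split; first by rewrite ltr_pdivlMr // [x * _]mulrC.
rewrite ler_pdivrMr // mulrDl mulVf; last by rewrite gt_eqF.
by rewrite intrD lerD // [x * _]mulrC.
Qed.

(** [pickle] codes the cell by a natural number, the form of selector expected by
    [measurable_fun_select] and [freeze]. *)
Lemma measurable_floor_scaled n : measurable_fun [set: measurableTypeR R]
  (fun x : measurableTypeR R => pickle (Num.floor (n.+1%:R * x) : int)).
Proof.
move=> _ B _; rewrite setTI.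
rewrite (_ : _ @^-1` B = \bigcup_(k in B) (if unpickle k is Some j then
   if pickle (j : int) == k then
   `[ (j%:~R : R) / n.+1%:R, (j + 1)%:~R / n.+1%:R [%classic else set0 else set0)).
  apply: bigcup_measurable => k _.
  case: unpickle => // j; case: ifP => // _.
have n0 : 0 < n.+1%:R :> R by rewrite ltr0n.
apply/seteqP; split=> x /=.
  move=> xB; exists (pickle (Num.floor (n.+1%:R * x))); first exact: xB.
  rewrite pickleK eqxx /= in_itv /=.
  by rewrite ler_pdivrMr // ltr_pdivlMr // [x * _]mulrC floor_itv.
move=> [k kB]; case: unpickle => // j; case: eqP => // jk /=.
rewrite in_itv /= ler_pdivrMr // ltr_pdivlMr // [x * _]mulrC.
by move=> /floor_def ->; rewrite jk.
Qed.

Definition rcont_path (x : {nonneg R} -> nat) := forall s : {nonneg R},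
  exists2 e : R, 0 < e & forall u : {nonneg R},
    s%:num <= u%:num < s%:num + e -> x u = x s.

Definition at_exp (x : {nonneg R} -> nat) (m : R) : nat := x (expR m)%:nng.

(** A margin [e] on the time scale becomes [ln (1 + e / expR m)] on the logarithmic scale, where the
    grid lives. *)
Lemma rcont_round_up (x : {nonneg R} -> nat) (m : R) : rcont_path x ->
  exists n0, forall n, (n0 <= n)%N -> at_exp x (round_up n m) = at_exp x m.
Proof.
move=> /(_ (expR m)%:nng) [e e0 xe].
have l0 : 0 < ln (1 + e / expR m) by rewrite ln_gt0 // ltrDl divr_gt0 ?expR_gt0.
have [n0 _ n0P] := @near_infty_natSinv_lt R (PosNum l0).
exists n0 => n nn0; apply: xe => /=.
have /andP[r1 r2] := round_up_bounds n m.
rewrite ler_expR ltW //= (@le_lt_trans _ _ (expR (m + n.+1%:R^-1))) ?ler_expR //.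
have -> : expR m + e = expR (m + ln (1 + e / expR m)).
  rewrite expRD lnK; last by rewrite posrE addr_gt0 // divr_gt0 // expR_gt0.
  by rewrite mulrDr mulr1 mulrCA mulfV ?mulr1 // gt_eqF // expR_gt0.
by rewrite ltr_expR ltrD2l; exact: n0P.
Qed.

End grid.

Lemma measurable_at_exp (R : realType) d (T : measurableType d)
    (N : {nonneg R} -> T -> nat) (U : T -> R) :
  (forall s, measurable_fun setT (N s)) -> (forall w, rcont_path (N ^~ w)) ->
  measurable_fun setT (U : T -> measurableTypeR R) ->
  measurable_fun setT (fun w => at_exp (N ^~ w) (U w)).
Proof.
move=> mN rN mU.
apply: (@measurable_fun_eventually _ _ _ _
  (fun n w => at_exp (N ^~ w) (round_up n (U w)))) => [n|w]; last exact: rcont_round_up.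
pose c w := pickle (Num.floor (n.+1%:R * U w) : int).
pose Phi k w := if unpickle k is Some j then at_exp (N ^~ w) (grid R n j) else 0%N.
rewrite (_ : (fun w => _) = (fun w => Phi (c w) w)); last first.
  by apply/funext => w; rewrite /Phi /c pickleK.
apply: measurable_fun_select.
  exact: (measurableT_comp (@measurable_floor_scaled R n) mU).
by move=> k; rewrite /Phi; case: unpickle => // j; exact: mN.
Qed.

(* Freezing: [N] may be integrated out at fixed times, [U] and [U'] being independent of it. *)
Lemma freeze_at_exp (R : realType) d (T : measurableType d) (P : probability T R)
    (F0 G0 : set (set T)) (N : {nonneg R} -> T -> nat) (U U' : T -> R)
    (f : nat -> nat -> \bar R) (H : T -> \bar R) (eps : R) :
  indep2 P <<s F0 >> <<s G0 >> ->
  <<s F0 >> `<=` measurable -> <<s G0 >> `<=` measurable ->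
  measurable_fun [set: g_sigma_algebraType F0] (U : _ -> measurableTypeR R) ->
  measurable_fun [set: g_sigma_algebraType F0] (U' : _ -> measurableTypeR R) ->
  (forall s, measurable_fun [set: g_sigma_algebraType G0] (N s)) ->
  (forall w, rcont_path (N ^~ w)) ->
  (forall a b, 0 <= f a b)%E ->
  measurable_fun setT H -> (forall w, 0 <= H w)%E -> 0 < eps ->
  (forall w x y, U w <= x <= U w + eps -> U' w <= y <= U' w + eps ->
    (\int[P]_v f (at_exp (N ^~ v) x) (at_exp (N ^~ v) y) <= H w)%E) ->
  (\int[P]_w f (at_exp (N ^~ w) (U w)) (at_exp (N ^~ w) (U' w)) <= \int[P]_w H w)%E.
Proof.
move=> FG Fm Gm mU mU' mN rN f0 mH H0 eps0 fH.
have mNT s : measurable_fun [set: T] (N s) by exact: measurable_fun_sub_sigma (mN s).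
pose g n w := f (at_exp (N ^~ w) (round_up n (U w))) (at_exp (N ^~ w) (round_up n (U' w))).
pose c n w := pickle (pickle (Num.floor (n.+1%:R * U w) : int),
                      pickle (Num.floor (n.+1%:R * U' w) : int)).
pose t n k w := if unpickle k is Some j then at_exp (N ^~ w) (grid R n j) else 0%N.
pose Phi n k w := if unpickle k is Some ab then f (t n ab.1 w) (t n ab.2 w) else 0%E.
have gE n w : g n w = Phi n (c n w) w by rewrite /Phi /c pickleK /t /= !pickleK.
(* The space is left arbitrary because measurability is needed twice: on [T], and for the
   sigma-algebra generated by [G0]. *)
have mt d0 (T0 : measurableType d0) (N0 : {nonneg R} -> T0 -> nat) n k :
    (forall s, measurable_fun setT (N0 s)) ->
    measurable_fun setT (fun w => if unpickle k is Some j
      then at_exp (N0 ^~ w) (grid R n j) else 0%N).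
  by move=> mN0; case: unpickle => // j; exact: mN0.
have mPhi d0 (T0 : measurableType d0) (N0 : {nonneg R} -> T0 -> nat) n k :
    (forall s, measurable_fun setT (N0 s)) ->
    measurable_fun setT (fun w => if unpickle k is Some ab then
      f (if unpickle ab.1 is Some j then at_exp (N0 ^~ w) (grid R n j) else 0%N)
        (if unpickle ab.2 is Some j then at_exp (N0 ^~ w) (grid R n j) else 0%N)
      else 0%E).
  move=> mN0; case: unpickle => [[a b] /=|]; last exact: measurable_cst.
  by apply: measurable_fun_nat2; apply: mt.
have mc n : measurable_fun [set: g_sigma_algebraType F0] (c n).
  apply: (@measurable_fun_nat2 _ (g_sigma_algebraType F0) _ _
    (fun a b => pickle (a, b))).
    exact: (measurableT_comp (@measurable_floor_scaled R n) mU).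
  exact: (measurableT_comp (@measurable_floor_scaled R n) mU').
have PhiE n w v : Phi n (c n w) v =
    f (at_exp (N ^~ v) (round_up n (U w))) (at_exp (N ^~ v) (round_up n (U' w))).
  by rewrite /Phi /c pickleK /t /= !pickleK.
(* Once the mesh is at most [eps], the rounded times fall in the windows where [fH] applies. *)
have gH n : (n.+1%:R^-1 <= eps)%R ->
    measurable_fun setT (g n) /\ (\int[P]_w g n w <= \int[P]_w H w)%E.
  move=> neps; have -> : g n = (fun w => Phi n (c n w) w) by exact/funext.
  apply: (@freeze _ _ _ _ <<s F0 >> <<s G0 >>) => //.
  - by move=> k; apply: (measurable_fun_g_sigma F0 (c n)).1 => //.
  - by move=> k; exact: mPhi.
  - by move=> k w; rewrite /Phi; case: unpickle => // -[].
  - move=> k; apply: (measurable_fun_g_sigma G0 (Phi n k)).1.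
    exact: (mPhi _ (g_sigma_algebraType G0)).
  - move=> w; under eq_integral do rewrite PhiE.
    have /andP[a1 a2] := round_up_bounds n (U w).
    have /andP[b1 b2] := round_up_bounds n (U' w).
    apply: fH; first by rewrite ltW //= (le_trans a2) // lerD2l.
    by rewrite ltW //= (le_trans b2) // lerD2l.
have [n0 _ n0P] := @near_infty_natSinv_lt R (PosNum eps0).
have gH' n : measurable_fun setT (g (n + n0)%N) /\
    (\int[P]_w g (n + n0)%N w <= \int[P]_w H w)%E.
  by apply: gH; apply/ltW/n0P; rewrite /= leq_addl.
(* Right-continuity makes the discretised integrand eventually constant at each [w], so Fatou's
   lemma transfers the bound. *)
have glim w : limn_einf (fun n => g (n + n0)%N w) =
    f (at_exp (N ^~ w) (U w)) (at_exp (N ^~ w) (U' w)).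
  have [m1 m1P] := rcont_round_up (U w) (rN w).
  have [m2 m2P] := rcont_round_up (U' w) (rN w).
  apply: (cvg_limn_einf_sup _).1; apply: cvg_near_cst.
  exists (m1 + m2)%N => // n /= nm; rewrite /g m1P ?m2P //.
    by rewrite (leq_trans _ (leq_addr _ _)) // (leq_trans _ nm) // leq_addl.
  by rewrite (leq_trans _ (leq_addr _ _)) // (leq_trans _ nm) // leq_addr.
under eq_integral do rewrite -glim.
apply: (le_trans (fatou P measurableT (fun n => (gH' n).1) _)) => [n w _|].
  exact: f0.
rewrite limn_einf_lim; apply: lime_le; first exact: is_cvg_einfs.
apply: nearW => n; apply: le_trans (gH' n).2.
by apply: ereal_inf_lbound; exists n => /=.
Qed.

(** * Poisson moments *)

Section poisson_sums.
Variable R : realType.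
Local Open Scope ereal_scope.

Lemma poisson_pmfE (r : R) (k : nat) : (0 < r)%R ->
  poisson_pmf r k = (r ^+ k * k`!%:R^-1 * expR (- r))%R.
Proof. by rewrite /poisson_pmf => ->. Qed.

Lemma sum_poisson_pmf (r : R) : (0 < r)%R -> \sum_(k <oo) (poisson_pmf r k)%:E = 1.
Proof.
move=> r0; have : poisson_prob r 0 [set: nat] = 1 by exact: probability_setT.
rewrite /poisson_prob r0 -nneseries_esumT //.
by move=> *; rewrite lee_fin poisson_pmf_ge0.
Qed.

Lemma sum_poisson_mean (r : R) : (0 < r)%R ->
  \sum_(k <oo) (k%:R * poisson_pmf r k)%:E = r%:E.
Proof.
move=> r0; have h0 k : 0 <= (k%:R * poisson_pmf r k)%:E.
  by rewrite lee_fin mulr_ge0 // poisson_pmf_ge0.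
rewrite nneseries_recl // mul0r add0e -[RHS]mule1 -(sum_poisson_pmf r0).
rewrite -nneseriesZl; last by move=> *; rewrite lee_fin poisson_pmf_ge0.
rewrite -(@nneseries_addn _ _ 1) //; apply: eq_eseriesr => k _.
rewrite addn1 -EFinM !poisson_pmfE //; congr EFin.
rewrite factS natrM exprS invfM.
have k0 : k.+1%:R != 0%R :> R by rewrite pnatr_eq0.
have f0 : k`!%:R != 0%R :> R by rewrite pnatr_eq0 -lt0n fact_gt0.
by rewrite -natr1 in k0 *; field; rewrite f0 k0.
Qed.

(** The term of rank [k] is [r^-1] times the mass at [k + 1]; the inequality only loses the mass at
    0. *)
Lemma sum_poisson_inv (r : R) : (0 < r)%R ->
  \sum_(k <oo) ((1 + k%:R)^-1 * poisson_pmf r k)%:E <= (r^-1)%:E.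
Proof.
move=> r0.
have p0 k : 0 <= (poisson_pmf r k)%:E by rewrite lee_fin poisson_pmf_ge0.
rewrite (_ : (r^-1)%:E = (r^-1)%:E * \sum_(k <oo) (poisson_pmf r k)%:E); last first.
  by rewrite sum_poisson_pmf // mule1.
rewrite [X in _ <= _ * X]nneseries_recl //.
apply: (@le_trans _ _ ((r^-1)%:E * \sum_(1 <= k <oo) (poisson_pmf r k)%:E)); last first.
  by apply: lee_wpmul2l; [rewrite lee_fin invr_ge0 ltW|rewrite leeDr].
rewrite -(@nneseries_addn _ _ 1) // -nneseriesZl //.
rewrite le_eqVlt; apply/orP; left; apply/eqP; apply: eq_eseriesr => k _.
rewrite addn1 -EFinM !poisson_pmfE //; congr EFin.
rewrite factS natrM exprS invfM.
have k0 : k.+1%:R != 0%R :> R by rewrite pnatr_eq0.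
have f0 : k`!%:R != 0%R :> R by rewrite pnatr_eq0 -lt0n fact_gt0.
rewrite -natr1 in k0 *; rewrite addrC.
by field; rewrite f0 k0 gt_eqF.
Qed.

(** The exponential factor tilts the law into the Poisson law of parameter [r * expR t], up to
    normalisation. *)
Lemma sum_poisson_laplace (r t : R) : (0 < r)%R ->
  \sum_(k <oo) (expR (t * k%:R) * poisson_pmf r k)%:E = (expR (r * (expR t - 1)))%:E.
Proof.
move=> r0; have re0 : (0 < r * expR t)%R by rewrite mulr_gt0 // expR_gt0.
rewrite -[RHS]mule1 -(sum_poisson_pmf re0).
rewrite -nneseriesZl; last by move=> *; rewrite lee_fin poisson_pmf_ge0.
apply: eq_eseriesr => k _; rewrite -EFinM !poisson_pmfE //; congr EFin.
rewrite exprMn -expRM_natr mulrBr mulr1 expRD mulrC.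
rewrite (_ : expR (- (r * expR t)) = (expR (r * expR t))^-1)%R ?expRN //.
by field; apply/and3P; split; rewrite ?gt_eqF ?expR_gt0 //.
Qed.

End poisson_sums.

Lemma ge0_integral_nat (R : realType) d (T : measurableType d)
    (P : probability T R) (X : T -> nat) (f : nat -> \bar R) :
  measurable_fun setT X -> (forall k, 0 <= f k)%E ->
  (\int[P]_w f (X w) = \sum_(k <oo) f k * P [set w | X w = k])%E.
Proof.
move=> mX f0.
have mXk k : measurable (X @^-1` [set k]).
  by rewrite -[X in measurable X]setTI; exact: mX.
have cT : \bigcup_k (X @^-1` [set k]) = setT.
  by apply/seteqP; split => // x _; exists (X x).
have mfX : measurable_fun setT (fun w => f (X w)).
  by apply: (@measurable_fun_nat2 _ _ _ _ (fun a _ => f a) X X).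
rewrite -[in LHS]cT ge0_integral_bigcup ?cT //; last first.
  by apply/trivIsetP => i j _ _ ij; apply/seteqP; split => x //= [-> /eqP]; rewrite (negbTE ij).
apply: eq_eseriesr => k _; rewrite -(integral_cst P (mXk k)) //.
by apply: eq_integral => w; rewrite inE /= => ->.
Qed.

Section poisson_process_moments.
Context (R : realType) d (T : measurableType d) (P : probability T R).
Variable N : {nonneg R} -> T -> nat.
Hypothesis ppN : poisson_process P N.

Let mN s : measurable_fun setT (N s) := measurable_count ppN s.

Lemma poisson_count (s : {nonneg R}) (k : nat) : 0 < s%:num ->
  P [set w | N s w = k] = (poisson_pmf s%:num k)%:E.
Proof.
move=> s0; transitivity (P [set w | (N s w - N (0%:nng)%R w)%N = k]).
  by congr (P _); apply/seteqP; split=> w /=; rewrite (count0 ppN) subn0.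
by rewrite (poisson_increments ppN) //= subr0.
Qed.

Lemma poisson_mean (s : {nonneg R}) : 0 < s%:num ->
  (\int[P]_w (N s w)%:R%:E = s%:num%:E)%E.
Proof.
move=> s0; rewrite (@ge0_integral_nat _ _ _ P (N s) (fun k => k%:R%:E)) //.
rewrite -[RHS](sum_poisson_mean s0).
by apply: eq_eseriesr => k _; rewrite poisson_count // -EFinM.
Qed.

Lemma poisson_laplace (s : {nonneg R}) (t : R) : 0 < s%:num ->
  (\int[P]_w (expR (t * (N s w)%:R))%:E = (expR (s%:num * (expR t - 1)))%:E)%E.
Proof.
move=> s0; rewrite (@ge0_integral_nat _ _ _ P (N s) (fun k => (expR (t * k%:R))%:E)) //.
rewrite -[RHS](sum_poisson_laplace t s0).
by apply: eq_eseriesr => k _; rewrite poisson_count // -EFinM.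
Qed.

Lemma poisson_inv (s : {nonneg R}) : 0 < s%:num ->
  (\int[P]_w ((1 + (N s w)%:R)^-1)%:E <= (s%:num^-1)%:E)%E.
Proof.
move=> s0; rewrite (@ge0_integral_nat _ _ _ P (N s) (fun k => ((1 + k%:R)^-1)%:E)) //.
apply: le_trans (sum_poisson_inv s0).
rewrite le_eqVlt; apply/orP; left; apply/eqP.
by apply: eq_eseriesr => k _; rewrite poisson_count // -EFinM.
Qed.

Lemma poisson_increment_mean (s u : {nonneg R}) : s%:num < u%:num ->
  (\int[P]_w (N u w - N s w)%N%:R%:E = (u%:num - s%:num)%:E)%E.
Proof.
move=> su; have mK : measurable_fun setT (fun w => (N u w - N s w)%N).
  by apply: (measurable_fun_nat2 subn); exact: mN.
rewrite (@ge0_integral_nat _ _ _ P _ (fun k => k%:R%:E)) //.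
have su0 : 0 < u%:num - s%:num by rewrite subr_gt0.
rewrite -[RHS](sum_poisson_mean su0).
by apply: eq_eseriesr => k _; rewrite (poisson_increments ppN) // -EFinM.
Qed.

Lemma poisson_increment_indep (s u : {nonneg R}) : s%:num < u%:num ->
  indep2 P (preimage_set_system [set: T] (fun w => N u w - N s w)%N measurable)
           (preimage_set_system [set: T] (N s) measurable).
Proof.
move=> su A B FA FB.
have [z z0 Nz] : exists2 z : {nonneg R}, z%:num = 0 & forall w, N z w = 0%N.
  by exists 0%:nng => // w; exact: count0 ppN w.
(* Along the times [0, s, u, u, ...] the first increment is [N s] itself, since the count starts at
   0, and the second is [N u - N s]. *)
pose t (k : nat) : {nonneg R} := if k is k'.+1 then if k' is 0%N then s else u else z.
have tle k : (t k)%:num <= (t k.+1)%:num by case: k => [|[|k]] //=; [rewrite z0|exact: ltW].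
have := @indep_increments _ _ _ _ _ ppN t tle [:: 0%N; 1%N] (fun k => if k is 0%N then B else A).
rewrite !big_cons big_nil mule1 muleC => <- //; last first.
  move=> i; rewrite !inE => /orP[] /eqP -> //=.
  move: FB => [C mC <-]; exists C => //.
  by apply/seteqP; split=> w /=; rewrite Nz subn0.
congr (P _); apply/seteqP; split=> [w [wA wB] i|w wAB].
  by rewrite /= !inE => /orP[] /eqP ->.
by split; [apply: (wAB 1%N)|apply: (wAB 0%N)].
Qed.

(** Freeze the increment and integrate [N s] out: [1 / (1 + N s)] contributes at most [1 / s], and
    the increment has mean [u - s]. *)
Lemma poisson_ratio_mean (s u : {nonneg R}) : 0 < s%:num -> s%:num < u%:num ->
  (\int[P]_w ((N u w - N s w)%N%:R / (1 + (N s w)%:R))%:E <=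
   ((u%:num - s%:num) / s%:num)%:E)%E.
Proof.
move=> s0 su; have mK : measurable_fun setT (fun w => (N u w - N s w)%N).
  by apply: (measurable_fun_nat2 subn); exact: mN.
have s'0 : (0 <= (s%:num^-1)%:E)%E by rewrite lee_fin invr_ge0.
pose Phi (k : nat) w : \bar R := (k%:R%:E * ((1 + (N s w)%:R)^-1)%:E)%E.
have mI : measurable_fun setT (fun w => ((1 + (N s w)%:R)^-1 : R)%:E).
  exact: (measurable_fun_nat2 (fun a _ : nat => ((1 + a%:R)^-1 : R)%:E) (mN s) (mN s)).
have mPhi k : measurable_fun setT (Phi k).
  exact: (measurable_fun_nat2
    (fun a _ : nat => (k%:R%:E * ((1 + a%:R)^-1 : R)%:E)%E) (mN s) (mN s)).
have [_] : measurable_fun setT (fun w => Phi (N u w - N s w)%N w) /\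
  (\int[P]_w Phi (N u w - N s w)%N w <=
   \int[P]_w ((s%:num^-1)%:E * (N u w - N s w)%N%:R%:E))%E.
  apply: (freeze (poisson_increment_indep su)) => //.
  - by move=> _ [C mC <-]; exact: mK.
  - by move=> k; exists [set k] => //; rewrite setTI.
  - by move=> k w; rewrite /Phi -EFinM lee_fin mulr_ge0 // invr_ge0 addr_ge0.
  - move=> k B mB; exists [set a | B (k%:R%:E * ((1 + a%:R)^-1)%:E)%E] => //.
    by rewrite setTI.
  - exact: (measurable_fun_nat2 (fun a _ : nat => ((s%:num^-1)%:E * a%:R%:E)%E) mK mK).
  - move=> w; rewrite ge0_integralZl_EFin //.
    by rewrite muleC; apply: lee_wpmul2r; [rewrite lee_fin|exact: poisson_inv].
rewrite ge0_integralZl_EFin //; last first.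
  exact: (measurable_fun_nat2 (fun a _ : nat => (a%:R%:E : \bar R)) mK mK).
by rewrite poisson_increment_mean // -EFinM mulrC.
Qed.

End poisson_process_moments.

Lemma expR_le1D2x (R : realType) (u : R) : 0 <= u <= 2^-1 -> expR u <= 1 + 2 * u.
Proof.
move=> /andP[u0 u2]; have h := expR_ge1Dx (- u).
have e0 := expR_gt0 u; rewrite expRN in h.
have h2 : (1 - u) * expR u <= 1.
  by rewrite -ler_pdivlMr // div1r.
nra.
Qed.

(** The price of a unit freezing window on the logarithmic scale, compensated by the 1/4 of
    [at_exp_laplace8]. *)
Lemma expR1_le4 (R : realType) : expR 1 <= 4 :> R.
Proof.
have h : expR 2^-1 <= 1 + 2 * 2^-1 :> R by apply: expR_le1D2x; rewrite invr_ge0 ler0n lexx.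
have -> : 1 = 2^-1 + 2^-1 :> R by lra.
have := expR_gt0 (2^-1 : R); rewrite expRD; nra.
Qed.

Section log_scale.
Context (R : realType) d (T : measurableType d) (P : probability T R).
Variable N : {nonneg R} -> T -> nat.
Hypothesis ppN : poisson_process P N.

Let mN s : measurable_fun setT (N s) := measurable_count ppN s.

Lemma at_exp_mean (x : R) : (\int[P]_w (at_exp (N ^~ w) x)%:R%:E = (expR x)%:E)%E.
Proof. by rewrite /at_exp (poisson_mean ppN) //= expR_gt0. Qed.

Lemma at_exp_laplace (x t : R) :
  (\int[P]_w (expR (t * (at_exp (N ^~ w) x)%:R))%:E =
   (expR (expR x * (expR t - 1)))%:E)%E.
Proof. by rewrite /at_exp (poisson_laplace ppN) //= expR_gt0. Qed.

Lemma at_exp_nondecr (x y : R) w : x <= y -> (at_exp (N ^~ w) x <= at_exp (N ^~ w) y)%N.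
Proof. by move=> xy; apply: (nondecr ppN); rewrite /= ler_expR. Qed.

(* The tangent of the logarithm at [b / a], which dominates the mean of the ratio of the
   two counts. *)
Lemma poisson_log_le (a b : {nonneg R}) : 0 < a%:num -> a%:num < b%:num ->
  (\int[P]_w (ln (1 + (N b w)%:R) - ln (1 + (N a w)%:R))%:E
   <= (ln (b%:num / a%:num))%:E)%E.
Proof.
move=> a0 ab; have b0 := lt_trans a0 ab.
set D := ln _; have D0 : 0 <= D by rewrite ln_ge0 // ler_pdivlMr // mul1r ltW.
pose K w : R := (N b w - N a w)%N%:R; pose z w : R := K w / (1 + (N a w)%:R).
pose l w : R := ln (1 + (N b w)%:R) - ln (1 + (N a w)%:R).
pose q : R := a%:num / b%:num.
have q0 : 0 < q by rewrite divr_gt0.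
have lnq : ln q = - D by rewrite /D -lnV ?posrE ?divr_gt0 // invf_div.
have z0 w : 0 <= z w by rewrite divr_ge0 // addr_ge0.
have p1 (n : nat) : 0 < 1 + n%:R :> R by rewrite ltr_pwDl.
have lz w : l w = ln (1 + z w).
  rewrite /l -ln_div ?posrE //; congr ln.
  have Nab : (N a w <= N b w)%N by apply: (nondecr ppN); exact: ltW.
  by rewrite /z /K natrB //; field; rewrite gt_eqF // p1.
have l0 w : 0 <= l w by rewrite lz ln_ge0 // lerDl.
(* With [q = a / b] and [D = - ln q], this is [ln v <= v - 1] at [v = q (1 + z)]. The mean of [q z]
   is at most [1 - q], so after integration only [D] remains. *)
have ltan w : l w + 1 <= D + q * (1 + z w).
  rewrite lz.
  have h : 0 < q * (1 + z w) by rewrite mulr_gt0 // ltr_pwDl.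
  have -> : ln (1 + z w) = D + ln (q * (1 + z w)).
    rewrite lnM ?posrE ?ltr_pwDl // lnq; ring.
  have := expR_ge1Dx (ln (q * (1 + z w))); rewrite lnK ?posrE //; lra.
have ml : measurable_fun setT (fun w => (l w)%:E).
  by apply: (measurable_fun_nat2
    (fun m n : nat => (ln (1 + n%:R) - ln (1 + m%:R) : R)%:E) (mN a) (mN b)).
have mz : measurable_fun setT (fun w => (z w)%:E).
  by apply: (measurable_fun_nat2
    (fun m n : nat => ((n - m)%N%:R / (1 + m%:R) : R)%:E) (mN a) (mN b)).
(* The 1 stays on the left so that both integrands are nonnegative. *)
have main : (\int[P]_w (l w)%:E + 1%:E <=
    (D + q)%:E + q%:E * \int[P]_w (z w)%:E)%E.
  rewrite -ge0_integralZl_EFin ?(ltW q0) //; last by move=> w _; rewrite lee_fin.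
  rewrite -(integral_cst_prob P 1) -(integral_cst_prob P (D + q)) -ge0_integralD //; last first.
    by move=> w _; rewrite lee_fin.
  rewrite -ge0_integralD //; last 3 first.
  - by move=> w _; rewrite lee_fin addr_ge0 // ltW.
  - by move=> w _; rewrite mule_ge0 // lee_fin // ltW.
  - exact: measurable_funeM.
  apply: ge0_le_integral => //.
  - by move=> w _; rewrite adde_ge0 // lee_fin.
  - by apply: emeasurable_funD.
  - by apply: emeasurable_funD => //; exact: measurable_funeM.
  - move=> w _ /=; rewrite -EFinM -!EFinD lee_fin; have := ltan w; lra.
have := poisson_ratio_mean ppN a0 ab; rewrite -/(K _) => zm.
have qab : q * ((b%:num - a%:num) / a%:num) = 1 - q.
  by rewrite /q; field; rewrite !gt_eqF.
have : (\int[P]_w (l w)%:E + 1%:E <= D%:E + 1%:E)%E.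
  apply: (le_trans main); rewrite -EFinD.
  apply: (@le_trans _ _ ((D + q)%:E + q%:E * ((b%:num - a%:num) / a%:num)%:E)%E).
    by rewrite leeD2l // lee_wpmul2l // lee_fin ltW.
  by rewrite -EFinM -EFinD lee_fin qab; lra.
by rewrite leeD2rE.
Qed.

Lemma log1_at_exp_le (x y : R) : x < y ->
  (\int[P]_w (ln (1 + (at_exp (N ^~ w) y)%:R) - ln (1 + (at_exp (N ^~ w) x)%:R))%:E
   <= (y - x)%:E)%E.
Proof.
move=> xy; apply: le_trans (poisson_log_le _ _) _; rewrite /= ?expR_gt0 ?ltr_expR //.
by rewrite lee_fin ln_div ?posrE ?expR_gt0 // !expRK.
Qed.

Lemma log1_at_exp_dist (x y : R) :
  (\int[P]_w (`|ln (1 + (at_exp (N ^~ w) x)%:R) - ln (1 + (at_exp (N ^~ w) y)%:R)|)%:E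
   <= (`|x - y|)%:E)%E.
Proof.
have mono (u v : R) w : u <= v ->
    ln (1 + (at_exp (N ^~ w) u)%:R) <= ln (1 + (at_exp (N ^~ w) v)%:R) :> R.
  move=> uv; rewrite ler_ln ?posrE ?ltr_pwDl // lerD2l ler_nat.
  exact: at_exp_nondecr.
have [xy|yx|->] := ltgtP x y.
- rewrite distrC gtr0_norm ?subr_gt0 //; apply: le_trans (log1_at_exp_le xy).
  rewrite le_eqVlt; apply/orP; left; apply/eqP; apply: eq_integral => w _.
  by rewrite distrC ger0_norm // subr_ge0 mono // ltW.
- rewrite gtr0_norm ?subr_gt0 //; apply: le_trans (log1_at_exp_le yx).
  rewrite le_eqVlt; apply/orP; left; apply/eqP; apply: eq_integral => w _.
  by rewrite ger0_norm // subr_ge0 mono // ltW.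
- rewrite subrr normr0; under eq_integral do rewrite subrr normr0.
  by rewrite integral0.
Qed.

(** By [expR_le1D2x], [expR (1/8) - 1 <= 1/4]. *)
Lemma at_exp_laplace8 (x : R) :
  (\int[P]_w (expR (8^-1 * (at_exp (N ^~ w) x)%:R))%:E <= (expR (expR x / 4))%:E)%E.
Proof.
rewrite at_exp_laplace lee_fin ler_expR ler_wpM2l ?expR_ge0 //.
have := @expR_le1D2x R 8^-1 _; rewrite invr_ge0 ler0n lef_pV2 ?posrE //= => /(_ _).
rewrite ler_nat => /(_ isT); lra.
Qed.

Definition moment_const (r : R) : R := expR (3 / 2 + r * ln (2 * r)).

(** A power of [1 + N] is dominated by an exponential [exp (th N)] whose slope is inversely
    proportional to the intensity, so that the Laplace transform at [th] stays bounded. In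
    [moment_const], [3 / 2] is [th <= 1/2] plus the bound 1 on the Laplace exponent. *)
Lemma log1_at_exp_moment (r x : R) : 0 < r ->
  (\int[P]_w (expR (r * ln (1 + (at_exp (N ^~ w) x)%:R)))%:E
   <= (moment_const r * expR (r * Num.max x 0))%:E)%E.
Proof.
move=> r0; set y := Num.max x 0.
have y0 : 0 <= y by rewrite le_max lexx orbT.
(* Replacing [x] by [y >= 0] ensures [th <= 1/2], the range of [expR_le1D2x]. *)
pose th : R := expR (- y) / 2.
have th0 : 0 < th by rewrite divr_gt0 // expR_gt0.
have th2 : th <= 2^-1.
  by rewrite ler_pdivrMr // mulVf // -expR0 ler_expR oppr_le0.
have ptw w : expR (r * ln (1 + (at_exp (N ^~ w) x)%:R)) <=
    expR (r * ln (2 * r) + 2^-1 + r * y) * expR (th * (at_exp (N ^~ w) y)%:R).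
  rewrite -expRD ler_expR.
  set n : R := (at_exp (N ^~ w) y)%:R.
  have n0 : 0 <= n by [].
  have p1 : 0 < 1 + n by rewrite ltr_pwDl.
  apply: (@le_trans _ _ (r * ln (1 + n))).
    rewrite ler_wpM2l ?(ltW r0) // ler_ln ?posrE ?ltr_pwDl // lerD2l ler_nat.
    by apply: at_exp_nondecr; rewrite le_max lexx.
  have tr0 : 0 < th * (1 + n) / r by rewrite divr_gt0 // mulr_gt0.
  have := expR_ge1Dx (ln (th * (1 + n) / r)); rewrite lnK ?posrE // => h.
  have lnE : ln (th * (1 + n) / r) = ln (1 + n) - y - ln (2 * r).
    have tn0 : 0 < th * (1 + n) by rewrite mulr_gt0.
    have lnth : ln th = - y - ln 2 by rewrite /th ln_div ?posrE ?expR_gt0 // expRK.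
    rewrite (ln_div tn0 r0) (lnM th0 p1) lnth lnM ?posrE //; ring.
  have := ler_wpM2l (ltW r0) h; rewrite lnE mulrCA mulfV ?gt_eqF // mulr1.
  nra.
have mA z : measurable_fun setT (fun w => at_exp (N ^~ w) z) by exact: mN.
apply: (@le_trans _ _ (\int[P]_w ((expR (r * ln (2 * r) + 2^-1 + r * y))%:E *
    (expR (th * (at_exp (N ^~ w) y)%:R))%:E))%E).
  apply: ge0_le_integral => //.
  - exact: (measurable_fun_nat2
      (fun a _ : nat => (expR (r * ln (1 + a%:R)) : R)%:E) (mA x) (mA x)).
  - exact: (measurable_fun_nat2 (fun a _ : nat => ((expR (r * ln (2 * r) + 2^-1 + r * y))%:E *
      (expR (th * a%:R) : R)%:E)%E) (mA y) (mA y)).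
  - by move=> w _; rewrite -EFinM lee_fin.
rewrite ge0_integralZl_EFin ?expR_ge0 //; last first.
  exact: (measurable_fun_nat2 (fun a _ : nat => (expR (th * a%:R) : R)%:E) (mA y) (mA y)).
rewrite at_exp_laplace -EFinM lee_fin /moment_const -!expRD ler_expR.
have e1 : expR y * (expR th - 1) <= 1.
  have h : expR th <= 1 + 2 * th by apply: expR_le1D2x; rewrite ltW.
  apply: (@le_trans _ _ (expR y * (2 * th))).
    by rewrite ler_wpM2l ?expR_ge0 // lerBlDl.
  rewrite le_eqVlt; apply/orP; left; apply/eqP.
  by rewrite /th expRN; field; rewrite gt_eqF // expR_gt0.
lra.
Qed.

End log_scale.

(** * The model and its Picard iterates *)

Section model.
Variables (R : realType) (p q : nat) (A B : 'I_q -> 'M[R]_p) (d : 'cV[R]_p).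

(** The recursion is written for a deterministic noise path [x], so that a time shift acts by plain
    substitution and [picard_shift] is a pointwise identity. *)
Definition counts (x : int -> 'I_p -> {nonneg R} -> nat) (U : int -> 'cV[R]_p)
    (t : int) : 'cV[nat]_p := \col_i at_exp (x t i) (U t i 0).

Definition regression (U : int -> 'cV[R]_p) (Y : int -> 'cV[nat]_p) (t : int) : 'cV[R]_p :=
  d + \sum_(j < q) A j *m U (t - j.+1%:Z) + \sum_(j < q) B j *m log1_vec (Y (t - j.+1%:Z)).

Definition step x U := regression U (counts x U).

Fixpoint picard x (n : nat) : int -> 'cV[R]_p :=
  if n is m.+1 then step x (picard x m) else fun=> 0.

Lemma regressionE U Y t i : regression U Y t i 0 = d i 0 +
  \sum_(l : 'I_q * 'I_p) (A l.1 i l.2 * U (t - l.1.+1%:Z) l.2 0 +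
                         B l.1 i l.2 * ln (1 + (Y (t - l.1.+1%:Z) l.2 0)%:R)).
Proof.
rewrite /regression !mxE !summxE -addrA -big_split /=; congr (_ + _).
rewrite -(pair_bigA _ (fun j k => A j i k * U (t - j.+1%:Z) k 0 +
  B j i k * ln (1 + (Y (t - j.+1%:Z) k 0)%:R))) /=.
apply: eq_bigr => j _; rewrite !mxE -big_split /=; apply: eq_bigr => k _.
by rewrite !mxE.
Qed.

Lemma counts_shift x U h t :
  counts (fun s => x (s + h)) (fun s => U (s + h)) t = counts x U (t + h).
Proof. by apply/colP => i; rewrite !mxE. Qed.

Lemma regression_shift U Y h t :
  regression (fun s => U (s + h)) (fun s => Y (s + h)) t = regression U Y (t + h).
Proof.
by rewrite /regression; congr (_ + _ + _); apply: eq_bigr => j _; rewrite addrAC.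
Qed.

Lemma picard_shift x h n t : picard (fun s => x (s + h)) n t = picard x n (t + h).
Proof.
elim: n t => [|n IH] t //=; rewrite /step -regression_shift; congr (regression _ _ t).
  by apply/funext => s; exact: IH.
apply/funext => s; rewrite -counts_shift; congr (counts _ _ s).
by apply/funext => r; exact: IH.
Qed.

Section model_measurability.
Context d' (T : measurableType d') (N : int -> 'I_p -> {nonneg R} -> T -> nat).

Definition path_of (w : T) : int -> 'I_p -> {nonneg R} -> nat := fun t i s => N t i s w.

Hypothesis rN : forall t i w, rcont_path (path_of w t i).

(** [T] is generic: these lemmas serve for the ambient sigma-algebra, for the pasts, and for the
    space carrying two copies of the noise. *)
Lemma measurable_counts (U : T -> int -> 'cV[R]_p) t i :
  (forall s, measurable_fun setT (N t i s)) ->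
  measurable_fun setT (fun w => U w t i 0 : measurableTypeR R) ->
  measurable_fun setT (fun w => counts (path_of w) (U w) t i 0).
Proof.
move=> mN mU; under eq_fun do rewrite mxE.
by apply: (@measurable_at_exp _ _ _ (N t i) (fun w => U w t i 0)) => // w; exact: rN.
Qed.

Lemma measurable_regression (U : T -> int -> 'cV[R]_p) (Y : T -> int -> 'cV[nat]_p) t i :
  (forall s k, s < t -> measurable_fun setT (fun w => U w s k 0 : measurableTypeR R)) ->
  (forall s k, s < t -> measurable_fun setT (fun w => Y w s k 0)) ->
  measurable_fun setT (fun w => regression (U w) (Y w) t i 0 : measurableTypeR R).
Proof.
move=> mU mY; under eq_fun do rewrite regressionE.
have lt (j : 'I_q) : t - j.+1%:Z < t by rewrite ltrBlDr ltrDl.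
apply: measurable_funD => //; apply: measurable_sum => l; apply: measurable_funD.
  by apply: measurable_funM => //; exact: mU.
apply: measurable_funM => //.
by apply: (measurable_fun_nat2 (fun a _ : nat => ln (1 + a%:R) : measurableTypeR R)
  (mY _ l.2 (lt l.1)) (mY _ l.2 (lt l.1))).
Qed.

Lemma measurable_picard n t i :
  (forall s k l, s < t -> measurable_fun setT (N s k l)) ->
  measurable_fun setT (fun w => picard (path_of w) n t i 0 : measurableTypeR R).
Proof.
elim: n t i => [|n IH] t i mN /=.
  by under eq_fun do rewrite mxE; exact: measurable_cst.
have mP s k : s < t -> measurable_fun setT
    (fun w => picard (path_of w) n s k 0 : measurableTypeR R).
  by move=> st; apply: IH => r l u rs; apply: mN; exact: lt_trans st.
apply: measurable_regression => // s k st.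
by apply: measurable_counts; [move=> u; exact: mN|exact: mP].
Qed.

End model_measurability.
End model.

Section innovations.
Context (R : realType) d (T : measurableType d) (P : probability T R) (p : nat).
Variable N : int -> 'I_p -> {nonneg R} -> T -> nat.

Definition law_gen (t : int) : set (set T) :=
  \bigcup_i preimage_set_system [set: T] (uncurry (N t) i) measurable.

(** Built from the sigma-algebras of the single times rather than from their generators, hence
    convertible with the definition of [past]. *)
Definition past_gen (t : int) : set (set T) :=
  \bigcup_(s in [set s : int | s <= t]) <<s law_gen s >>.

Definition adapted (t : int) (f : T -> measurableTypeR R) :=
  measurable_fun [set: g_sigma_algebraType (past_gen t)] f.

Lemma past_genE t : past N t = <<s past_gen t >>. Proof. by []. Qed.

Lemma past_gen_mono s t : s <= t -> past_gen s `<=` past_gen t.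
Proof. by move=> st A [r /= rs rA]; exists r => //=; exact: le_trans st. Qed.

Lemma adapted_mono s t f : s <= t -> adapted s f -> adapted t f.
Proof.
move=> st /measurable_fun_g_sigma af; apply/measurable_fun_g_sigma => B mB.
by apply: sub_sigma_algebra2 (af B mB); exact: past_gen_mono.
Qed.

Lemma measurable_law_gen t i s :
  measurable_fun [set: g_sigma_algebraType (law_gen t)] (N t i s).
Proof.
apply/measurable_fun_g_sigma => B mB; apply: sub_sigma_algebra.
by exists (i, s) => //; exists B => //; rewrite setTI.
Qed.

Lemma measurable_past_gen t u i s : u <= t ->
  measurable_fun [set: g_sigma_algebraType (past_gen t)] (N u i s).
Proof.
move=> ut; apply/measurable_fun_g_sigma => B mB; apply: sub_sigma_algebra.
exists u => //; apply: ((measurable_fun_g_sigma (law_gen u) (N u i s)).1 _ _ mB).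
exact: measurable_law_gen.
Qed.

Hypothesis hN : iid_poisson P N.

Let ppN t i : poisson_process P (N t i) := hN.2 t i.

Lemma rcont_path_of t i w : rcont_path (path_of N w t i).
Proof. exact: (rcont (ppN t i) w). Qed.

Lemma measurable_innovation t i s : measurable_fun setT (N t i s).
Proof. exact: (measurable_count (ppN t i)). Qed.

Lemma law_gen_sub t : <<s law_gen t >> `<=` measurable.
Proof.
apply: smallest_sub; first exact: sigma_algebra_measurable.
by move=> A [[i s] _ [B mB <-]]; exact: measurable_innovation.
Qed.

Lemma past_gen_sub t : <<s past_gen t >> `<=` measurable.
Proof.
apply: smallest_sub; first exact: sigma_algebra_measurable.
by move=> A [s _]; exact: law_gen_sub.
Qed.

Lemma adapted_measurable t f : adapted t f -> measurable_fun setT f.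
Proof. by apply: measurable_fun_sub_sigma; exact: past_gen_sub. Qed.

Lemma past_indep t : indep2 P <<s past_gen (t - 1) >> <<s law_gen t >>.
Proof.
apply: (independent_generated (F := fun s => <<s law_gen s >>)).
- exact: hN.1.1.
- by move=> s A B; exact: (@measurableI _ (g_sigma_algebraType (law_gen s))).
- by move=> s; exact: (@measurableT _ (g_sigma_algebraType (law_gen s))).
- exact: law_gen_sub.
- by rewrite /= -subr_ge0 addrAC subrr.
Qed.

Lemma freeze_innovation t i (U U' : T -> R) (f : nat -> nat -> \bar R)
    (H : T -> \bar R) (eps : R) :
  adapted (t - 1) U -> adapted (t - 1) U' -> (forall a b, 0 <= f a b)%E ->
  measurable_fun setT H -> (forall w, 0 <= H w)%E -> 0 < eps ->
  (forall w x y, U w <= x <= U w + eps -> U' w <= y <= U' w + eps ->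
    (\int[P]_v f (at_exp (path_of N v t i) x) (at_exp (path_of N v t i) y) <= H w)%E) ->
  (\int[P]_w f (at_exp (path_of N w t i) (U w)) (at_exp (path_of N w t i) (U' w))
   <= \int[P]_w H w)%E.
Proof.
move=> aU aU' f0 mH H0 eps0 fH.
apply: (freeze_at_exp (@past_indep t) (@past_gen_sub (t - 1)) (@law_gen_sub t)
  aU aU' _ _ f0 mH H0 eps0 fH) => [s|w]; first exact: measurable_law_gen.
exact: (rcont_path_of t i w).
Qed.

Lemma log1_innovation_dist t i (U U' : T -> R) :
  adapted (t - 1) U -> adapted (t - 1) U' ->
  (\int[P]_w (`|ln (1 + (at_exp (path_of N w t i) (U w))%:R)
               - ln (1 + (at_exp (path_of N w t i) (U' w))%:R)|)%:E
   <= \int[P]_w (`|U w - U' w|)%:E)%E.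
Proof.
move=> aU aU'; apply/lee_addgt0Pr => e e0.
have mU := adapted_measurable aU; have mU' := adapted_measurable aU'.
have mD : measurable_fun setT (fun w => (`|U w - U' w|)%:E).
  apply/measurable_EFinP; apply: measurableT_comp => //.
  exact: measurable_funB.
pose f (a b : nat) : \bar R := (`|ln (1 + a%:R) - ln (1 + b%:R)|)%:E.
apply: (@le_trans _ _ (\int[P]_w ((`|U w - U' w|)%:E + cst e%:E w)))%E.
  apply: (@freeze_innovation t i U U' f _ e) => //.
  - by move=> a b; rewrite lee_fin.
  - exact: emeasurable_funD.
  - by move=> w; rewrite -EFinD lee_fin addr_ge0 // ltW.
  - move=> w x y /andP[x1 x2] /andP[y1 y2].
    apply: (le_trans (log1_at_exp_dist (ppN t i) x y)).
    rewrite -EFinD lee_fin ler_norml.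
    have := ler_norm (U w - U' w); have := ler_norm (- (U w - U' w)).
    rewrite normrN => h1 h2; apply/andP; split; lra.
rewrite ge0_integralD //; last by move=> w _; rewrite lee_fin ltW.
by rewrite integral_cst_prob.
Qed.

End innovations.

(** * Contraction and moments *)

Lemma weights_lags (R : realType) (p q : nat) (A B : 'I_q -> 'M[R]_p) (w : 'I_p -> R) i :
  \sum_k (\sum_j (abs_mx (A j) + abs_mx (B j))) i k * w k =
  \sum_(l : 'I_q * 'I_p) (`|A l.1 i l.2| + `|B l.1 i l.2|) * w l.2.
Proof.
rewrite -(pair_bigA _ (fun j k => (`|A j i k| + `|B j i k|) * w k)) /= exchange_big /=.
apply: eq_bigr => k _; rewrite summxE mulr_suml; apply: eq_bigr => j _.
by rewrite !mxE.
Qed.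

Section contraction.
Context (R : realType) d (T : measurableType d) (P : probability T R) (p q : nat).
Variables (A B : 'I_q -> 'M[R]_p) (b : 'cV[R]_p).
Variable N : int -> 'I_p -> {nonneg R} -> T -> nat.
Hypothesis hN : iid_poisson P N.
Variables (w : 'I_p -> R) (c : R).
Hypothesis w0 : forall i, 0 < w i.
Hypothesis Gw : forall i,
  \sum_(l : 'I_q * 'I_p) (`|A l.1 i l.2| + `|B l.1 i l.2|) * w l.2 <= c * w i.

Definition predictable (U : T -> int -> 'cV[R]_p) :=
  forall t i, adapted N (t - 1) (fun x => U x t i 0).

Definition step_of (U : T -> int -> 'cV[R]_p) (x : T) : int -> 'cV[R]_p :=
  step A B b (path_of N x) (U x).

Let rN t i x : rcont_path (path_of N x t i) := rcont_path_of hN t i x.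

Lemma predictable_measurable U t i : predictable U ->
  measurable_fun setT (fun x => U x t i 0 : measurableTypeR R).
Proof. by move=> pU; exact: (adapted_measurable hN (pU t i)). Qed.

Lemma predictable_adapted U s t k : predictable U -> s <= t + 1 ->
  adapted N t (fun x => U x s k 0).
Proof. by move=> pU st; apply: adapted_mono (pU s k); rewrite lerBlDr. Qed.

Lemma step_predictable U : predictable U -> predictable (step_of U).
Proof.
move=> pU t i.
have ltle (s : int) : s < t -> s <= t - 1 by rewrite lerBrDr lezD1.
have aU s k : s < t -> adapted N (t - 1) (fun x => U x s k 0).
  by move=> st; apply: predictable_adapted => //; rewrite subrK ltW.
apply: (@measurable_regression _ _ _ _ _ _ _
  (g_sigma_algebraType (past_gen N (t - 1))) U
  (fun x => counts (path_of N x) (U x)) t i) => s k st; first exact: aU.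
apply: (@measurable_counts _ _ _ (g_sigma_algebraType (past_gen N (t - 1))) N) => //.
- by move=> u; apply: measurable_past_gen; exact: ltle.
- exact: aU.
Qed.

Lemma picard_predictable n : predictable (fun x => picard A B b (path_of N x) n).
Proof.
elim: n => [|n IH]; last exact: step_predictable IH.
move=> t i; rewrite /adapted /=.
by under eq_fun do rewrite mxE; exact: measurable_cst.
Qed.

Lemma regression_dist U U' Y Y' t i :
  `|regression A B b U Y t i 0 - regression A B b U' Y' t i 0| <=
  \sum_(l : 'I_q * 'I_p)
    (`|A l.1 i l.2| * `|U (t - l.1.+1%:Z) l.2 0 - U' (t - l.1.+1%:Z) l.2 0| +
     `|B l.1 i l.2| * `|ln (1 + (Y (t - l.1.+1%:Z) l.2 0)%:R)
                        - ln (1 + (Y' (t - l.1.+1%:Z) l.2 0)%:R)|).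
Proof.
rewrite !regressionE opprD addrACA subrr add0r -sumrB.
apply: le_trans (ler_norm_sum _ _ _) _; apply: ler_sum => l _.
rewrite -!normrM !mulrBr opprD addrACA; exact: ler_normD.
Qed.

Lemma measurable_dist (f g : T -> measurableTypeR R) :
  measurable_fun setT f -> measurable_fun setT g ->
  measurable_fun setT (fun x => (`|f x - g x|)%:E).
Proof.
move=> mf mg; apply/measurable_EFinP; apply: measurableT_comp => //.
exact: measurable_funB.
Qed.

Lemma measurable_log1 (Y : T -> nat) : measurable_fun setT Y ->
  measurable_fun setT (fun x => ln (1 + (Y x)%:R) : measurableTypeR R).
Proof.
move=> mY.
exact: (measurable_fun_nat2 (fun a _ : nat => ln (1 + a%:R) : measurableTypeR R) mY mY).
Qed.

Lemma measurable_counts_of U t i : predictable U ->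
  measurable_fun setT (fun x => counts (path_of N x) (U x) t i 0).
Proof.
move=> pU; apply: (@measurable_counts _ _ _ _ N) => //.
- by move=> s; exact: measurable_innovation hN t i s.
- exact: predictable_measurable.
Qed.

Lemma log1_counts_dist U U' t i : predictable U -> predictable U' ->
  (\int[P]_x (`|ln (1 + (counts (path_of N x) (U x) t i 0)%:R)
               - ln (1 + (counts (path_of N x) (U' x) t i 0)%:R)|)%:E
   <= \int[P]_x (`|U x t i 0 - U' x t i 0|)%:E)%E.
Proof.
move=> pU pU'; under eq_integral do rewrite !mxE.
exact: (log1_innovation_dist hN).
Qed.

(** In mean, a Poisson draw followed by the logarithm does not increase distances, so the terms in
    [B] obey the same bound as those in [A] and the two matrices add up in [Gw]. *)
Lemma step_contraction U U' (e : R) : predictable U -> predictable U' ->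
  (forall t i, (\int[P]_x (`|U x t i 0 - U' x t i 0|)%:E <= (e * w i)%:E)%E) ->
  forall t i, (\int[P]_x (`|step_of U x t i 0 - step_of U' x t i 0|)%:E
    <= (c * e * w i)%:E)%E.
Proof.
move=> pU pU' He t i.
have e0 : 0 <= e.
  have : (0 <= (e * w i)%:E)%E by apply: le_trans (He t i); exact: integral_ge0.
  by rewrite lee_fin pmulr_lge0.
pose DU (l : 'I_q * 'I_p) x :=
  (`|U x (t - l.1.+1%:Z) l.2 0 - U' x (t - l.1.+1%:Z) l.2 0|)%:E.
pose DL (l : 'I_q * 'I_p) x : \bar R :=
  (`|ln (1 + (counts (path_of N x) (U x) (t - l.1.+1%:Z) l.2 0)%:R)
     - ln (1 + (counts (path_of N x) (U' x) (t - l.1.+1%:Z) l.2 0)%:R)|)%:E.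
have mDU l : measurable_fun setT (DU l).
  by apply: measurable_dist; exact: predictable_measurable.
have mDL l : measurable_fun setT (DL l).
  by apply: measurable_dist; apply: measurable_log1; exact: measurable_counts_of.
have DU0 l x : (0 <= DU l x)%E by rewrite lee_fin.
have DL0 l x : (0 <= DL l x)%E by rewrite lee_fin.
pose F (l : 'I_q * 'I_p) x := ((`|A l.1 i l.2|)%:E * DU l x + (`|B l.1 i l.2|)%:E * DL l x)%E.
have F0 l x : (0 <= F l x)%E by rewrite adde_ge0 // mule_ge0 // lee_fin.
have mF l : measurable_fun setT (F l).
  by apply: emeasurable_funD; exact: measurable_funeM.
apply: (@le_trans _ _ (\int[P]_x \sum_(l : 'I_q * 'I_p) F l x)%E).
  apply: ge0_le_integral => //.
  - by apply: measurable_dist; apply: predictable_measurable; exact: step_predictable.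
  - exact: emeasurable_sum.
  - move=> x _; rewrite /F sumEFin lee_fin; exact: regression_dist.
rewrite ge0_integral_sum //.
apply: (@le_trans _ _
  (\sum_(l : 'I_q * 'I_p) ((`|A l.1 i l.2| + `|B l.1 i l.2|) * w l.2 * e)%:E)%E).
  apply: lee_sum => l _.
  rewrite /F ge0_integralD //; last 4 first.
  - by move=> x _; rewrite mule_ge0 // lee_fin.
  - exact: measurable_funeM.
  - by move=> x _; rewrite mule_ge0 // lee_fin.
  - exact: measurable_funeM.
  rewrite !ge0_integralZl_EFin //.
  apply: (@le_trans _ _
    ((`|A l.1 i l.2|)%:E * (e * w l.2)%:E + (`|B l.1 i l.2|)%:E * (e * w l.2)%:E)%E).
    apply: leeD; apply: lee_wpmul2l; rewrite ?lee_fin //; first exact: He.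
    by apply: le_trans (He (t - l.1.+1%:Z) l.2); exact: log1_counts_dist.
  by rewrite -!EFinM -EFinD lee_fin le_eqVlt; apply/orP; left; apply/eqP; ring.
rewrite sumEFin lee_fin -mulr_suml mulrAC; exact: ler_wpM2r.
Qed.

End contraction.

(** The term [F 0] pays for the default value 0 of the maximum. *)
Lemma le_max_sum (R : realType) (I : Type) (r : seq I) (a : I -> R) (F : R -> R) :
  (forall x, 0 <= F x) ->
  F (\big[Num.max/0]_(l <- r) a l) <= F 0 + \sum_(l <- r) F (a l).
Proof.
move=> F0; elim: r => [|l r IH]; first by rewrite !big_nil addr0.
rewrite !big_cons; have [_|_] := leP (a l) (\big[Num.max/0]_(j <- r) a j).
  by rewrite addrCA (le_trans IH) // lerDr.
by rewrite addrCA lerDl addr_ge0 // sumr_ge0.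
Qed.

Section moments.
Context (R : realType) d (T : measurableType d) (P : probability T R) (p q : nat).
Variables (A B : 'I_q -> 'M[R]_p) (b : 'cV[R]_p).
Variable N : int -> 'I_p -> {nonneg R} -> T -> nat.
Hypothesis hN : iid_poisson P N.
Variables (w : 'I_p -> R) (c : R).
Hypothesis w0 : forall i, 0 < w i.
Hypothesis Gw : forall i,
  \sum_(l : 'I_q * 'I_p) (`|A l.1 i l.2| + `|B l.1 i l.2|) * w l.2 <= c * w i.

Lemma regression_bound (U : int -> 'cV[R]_p) (Y : int -> 'cV[nat]_p) t i (m : R) : 0 <= m ->
  (forall l : 'I_q * 'I_p, `|U (t - l.1.+1%:Z) l.2 0| / w l.2 <= m) ->
  (forall l : 'I_q * 'I_p, ln (1 + (Y (t - l.1.+1%:Z) l.2 0)%:R) / w l.2 <= m) ->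
  `|regression A B b U Y t i 0| / w i <= `|b i 0| / w i + c * m.
Proof.
move=> m0 mU mY; rewrite ler_pdivrMr // mulrDl divfK ?gt_eqF // regressionE.
apply: le_trans (ler_normD _ _) _; rewrite lerD2l.
apply: le_trans (ler_norm_sum _ _ _) _.
apply: (@le_trans _ _ (\sum_(l : 'I_q * 'I_p) (`|A l.1 i l.2| + `|B l.1 i l.2|) * w l.2 * m)).
  apply: ler_sum => l _; apply: le_trans (ler_normD _ _) _.
  rewrite !normrM -mulrA mulrDl; apply: lerD; apply: ler_wpM2l => //.
    by rewrite mulrC -ler_pdivrMr.
  rewrite ger0_norm; first by rewrite mulrC -ler_pdivrMr.
  by rewrite ln_ge0 // lerDl.
rewrite -mulr_suml mulrAC ler_wpM2r //.
Qed.

Variables (Psi Phi : R -> R).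
Hypothesis Psi_mono : forall x y, 0 <= x -> x <= y -> Psi x <= Psi y.
Hypothesis Phi0 : forall x, 0 <= Phi x.
Hypothesis PhiPsi : forall x, Phi x <= Psi x.
Hypothesis mPsi : measurable_fun setT (Psi : measurableTypeR R -> measurableTypeR R).
Hypothesis mPhi : measurable_fun setT (Phi : measurableTypeR R -> measurableTypeR R).
Hypothesis growth : forall D eps, 0 <= D -> 0 < eps ->
  exists2 C, 0 <= C & forall v, 0 <= v -> Psi (D + c * v) <= eps * Phi v + C.
Variable C1 : R.
Hypothesis C10 : 0 <= C1.
Hypothesis innovation_moment : forall t k x x', x <= x' <= x + 1 ->
  (\int[P]_v (Phi (ln (1 + (at_exp (path_of N v t k) x')%:R) / w k))%:E
   <= (C1 * Psi (`|x| / w k))%:E)%E.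

Let Psi0 x : 0 <= Psi x. Proof. exact: le_trans (PhiPsi x). Qed.

Let mabs (g : T -> measurableTypeR R) k : measurable_fun setT g ->
  measurable_fun setT (fun x => `|g x| / w k : measurableTypeR R).
Proof. by move=> mg; apply: measurable_funM => //; apply: measurableT_comp. Qed.

Lemma counts_moment U t k : predictable N U ->
  (\int[P]_x (Phi (ln (1 + (counts (path_of N x) (U x) t k 0)%:R) / w k))%:E
   <= C1%:E * \int[P]_x (Psi (`|U x t k 0| / w k))%:E)%E.
Proof.
move=> pU; have mU := predictable_measurable hN t k pU.
have mPU : measurable_fun setT (fun x => (Psi (`|U x t k 0| / w k))%:E).
  by apply/measurable_EFinP; apply: measurableT_comp mPsi _; exact: mabs.
rewrite -ge0_integralZl_EFin //; last by move=> x _; rewrite lee_fin.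
under [X in (X <= _)%E]eq_integral do rewrite mxE.
pose f (a _ : nat) : \bar R := (Phi (ln (1 + a%:R) / w k))%:E.
apply: (freeze_innovation hN (f := f) (eps := 1) (pU t k) (pU t k)) => //.
- by move=> a ?; rewrite /f lee_fin.
- exact: measurable_funeM.
- by move=> x; rewrite mule_ge0 // lee_fin.
- by move=> x u v uU _; rewrite /f -EFinM; exact: innovation_moment.
Qed.

Lemma picard_moment : exists2 K, 0 <= K & forall n t i,
  (\int[P]_x (Psi (`|picard A B b (path_of N x) n t i 0| / w i))%:E <= K%:E)%E.
Proof.
pose D := \sum_i `|b i 0| / w i.
have D0 : 0 <= D by apply: sumr_ge0 => i _; rewrite divr_ge0 // ltW.
pose M : R := #|{: 'I_q * 'I_p}|%:R.
have M0 : 0 <= M by [].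
(* Each of the [M] pairs of a lag and a coordinate contributes at most [K] through the past
   intensity and [C1 * K] through the count; this [eps] keeps their total below [K / 2]. *)
pose eps := (2 * (M * (1 + C1) + 1))^-1.
have eps0 : 0 < eps by rewrite invr_gt0 mulr_gt0 // ltr_wpDl // mulr_ge0 // addr_ge0.
have [C C0 growthC] := growth D0 eps0.
(* [Psi 0] covers the null initial iterate; the other bound makes the constant terms at most
   [K / 2]. *)
pose K := Num.max (Psi 0) (2 * (eps * Phi 0 + C)).
have K0 : 0 <= K by rewrite le_max Psi0.
exists K => //; elim=> [|n IH] t i /=.
  under eq_integral do rewrite mxE normr0 mul0r.
  rewrite integral_cst_prob.
  by rewrite lee_fin le_max lexx.
pose U x := picard A B b (path_of N x) n.
have pU : predictable N U by exact: (picard_predictable A B b hN n).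
pose a (l : 'I_q * 'I_p) x := `|U x (t - l.1.+1%:Z) l.2 0| / w l.2.
pose e (l : 'I_q * 'I_p) x :=
  ln (1 + (counts (path_of N x) (U x) (t - l.1.+1%:Z) l.2 0)%:R) / w l.2.
have ma l : measurable_fun setT (a l : _ -> measurableTypeR R).
  by apply: mabs; exact: (predictable_measurable hN).
have me l : measurable_fun setT (e l : _ -> measurableTypeR R).
  apply: measurable_funM => //; apply: measurable_log1.
  exact: (measurable_counts_of hN).
have mPa l : measurable_fun setT (fun x => (Phi (a l x))%:E).
  by apply/measurable_EFinP; exact: measurableT_comp mPhi (ma l).
have mPe l : measurable_fun setT (fun x => (Phi (e l x))%:E).
  by apply/measurable_EFinP; exact: measurableT_comp mPhi (me l).
pose S l x := ((Phi (a l x))%:E + (Phi (e l x))%:E)%E.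
have S0 l x : (0 <= S l x)%E by rewrite adde_ge0 // lee_fin.
have mS l : measurable_fun setT (S l) by exact: emeasurable_funD.
have ptw x : Psi (`|step A B b (path_of N x) (U x) t i 0| / w i) <=
    eps * (Phi 0 + \sum_l (Phi (a l x) + Phi (e l x))) + C.
  (* Bounding the recursion through the largest argument requires only monotonicity of [Psi], no
     convexity. *)
  pose m := \big[Num.max/0]_l Num.max (a l x) (e l x).
  have mm l : Num.max (a l x) (e l x) <= m.
    exact: (le_bigmax 0 (fun l => Num.max (a l x) (e l x))).
  have m0 : 0 <= m by exact: bigmax_ge_id.
  apply: (@le_trans _ _ (Psi (D + c * m))).
    apply: Psi_mono; first by rewrite divr_ge0 // ltW.
    apply: (@le_trans _ _ (`|b i 0| / w i + c * m)).
      apply: regression_bound => // l; apply: le_trans (mm l); rewrite le_max lexx //.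
      by rewrite orbT.
    rewrite lerD2r /D (bigD1 i) //= lerDl sumr_ge0 // => k _.
    by rewrite divr_ge0 // ltW.
  apply: (le_trans (growthC m m0)); rewrite lerD2r ler_wpM2l ?(ltW eps0) //.
  apply: (le_trans (le_max_sum _ _ Phi0)); rewrite lerD2l; apply: ler_sum => l _.
  by rewrite maxEle; case: ifP => _; rewrite ?lerDl ?lerDr.
have SK l : (\int[P]_x S l x <= ((1 + C1) * K)%:E)%E.
  rewrite ge0_integralD //; last 2 first.
  - by move=> x _; rewrite lee_fin.
  - by move=> x _; rewrite lee_fin.
  rewrite mulrDl mul1r EFinD; apply: leeD.
    apply: le_trans (IH (t - l.1.+1%:Z) l.2); apply: ge0_le_integral => //.
    - by move=> x _; rewrite lee_fin.
    - by apply/measurable_EFinP; exact: measurableT_comp mPsi (ma l).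
    - by move=> x _; rewrite lee_fin.
  apply: le_trans (counts_moment _ _ pU) _.
  by rewrite EFinM; apply: lee_wpmul2l; [rewrite lee_fin|exact: IH].
have mstep : measurable_fun setT
    (fun x => (Psi (`|step A B b (path_of N x) (U x) t i 0| / w i))%:E).
  apply/measurable_EFinP; apply: measurableT_comp mPsi _; apply: mabs.
  exact: (predictable_measurable hN t i (step_predictable A B b hN pU)).
apply: (@le_trans _ _ (\int[P]_x (cst (eps * Phi 0 + C)%:E x + eps%:E * \sum_l S l x))%E).
  apply: ge0_le_integral => //.
  - by move=> x _; rewrite lee_fin.
  - by apply: emeasurable_funD => //; apply: measurable_funeM; exact: emeasurable_sum.
  - move=> x _; rewrite /S; under eq_bigr do rewrite -EFinD.
    rewrite sumEFin -EFinM -EFinD lee_fin; apply: le_trans (ptw x) _.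
    by rewrite mulrDr addrAC.
rewrite ge0_integralD //; last 3 first.
- by move=> x _; rewrite lee_fin addr_ge0 // mulr_ge0 // ltW.
- by move=> x _; rewrite mule_ge0 ?lee_fin ?(ltW eps0) // sume_ge0.
- by apply: measurable_funeM; exact: emeasurable_sum.
rewrite integral_cst_prob.
rewrite ge0_integralZl_EFin //; last 3 first.
- by move=> x _; rewrite sume_ge0.
- exact: emeasurable_sum.
- exact: ltW.
rewrite ge0_integral_sum //.
apply: (@le_trans _ _ ((eps * Phi 0 + C)%:E + eps%:E * \sum_(l : 'I_q * 'I_p) ((1 + C1) * K)%:E)%E).
  rewrite leeD2l // lee_wpmul2l ?lee_fin ?(ltW eps0) //.
  by apply: lee_sum => l _; exact: SK.
rewrite sumEFin -EFinM -EFinD lee_fin sumr_const -[_ *+ _]mulr_natl -/M.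
have h1 : eps * (M * (1 + C1)) <= 2^-1.
  rewrite /eps mulrC ler_pdivrMr; last first.
    by rewrite mulr_gt0 // ltr_wpDl // mulr_ge0 // addr_ge0.
  rewrite mulrA mulVf // mul1r lerDl //.
have h2 : 2 * (eps * Phi 0 + C) <= K by rewrite le_max lexx orbT.
have h3 : eps * (M * (1 + C1)) * K <= 2^-1 * K by rewrite ler_wpM2r.
lra.
Qed.

End moments.

(** * The stationary solution *)

Lemma nneseries_geometric_lty (R : realType) (a c : R) : 0 < c < 1 ->
  (\sum_(n <oo) (a * c ^+ n)%:E < +oo)%E.
Proof.
move=> /andP[c0 c1]; have c1' : `|c| < 1 by rewrite gtr0_norm.
have h : (fun n => (\sum_(0 <= k < n) (a * c ^+ k)%:E)%E) =
    EFin \o series (geometric a c).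
  by apply/funext => n /=; rewrite sumEFin.
rewrite h EFin_lim ?ltry //; exact: is_cvg_geometric_series.
Qed.

Lemma ae_eq0_geometric (R : realType) d (T : measurableType d) (P : probability T R)
    (f : T -> measurableTypeR R) (a c : R) : 0 < c < 1 -> measurable_fun setT f ->
  (forall n, (\int[P]_x (`|f x|)%:E <= (a * c ^+ n)%:E)%E) ->
  {ae P, forall x, f x = 0}.
Proof.
move=> /andP[c0 c1] mf small.
have I0 : (\int[P]_x (`|f x|)%:E = 0)%E.
  apply/eqP; rewrite eq_le integral_ge0 ?andbT; last by move=> x _; rewrite lee_fin.
  have cg : (geometric a c n)%:E @[n --> \oo] --> (0 : R)%:E.
    by apply: cvg_EFin; [exact: nearW|apply: cvg_geometric; rewrite gtr0_norm].
  apply: (@le_trans _ _ (limn (fun n => (geometric a c n)%:E))); last first.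
    by rewrite (cvg_lim _ cg).
  apply: lime_ge; first by apply/cvg_ex; exists (0 : R)%:E.
  by apply: nearW => n; exact: small.
have : ae_eq P setT (fun x => (f x : R)%:E) (cst 0%E).
  apply/(ae_eq_integral_abs P measurableT); first exact/measurable_EFinP.
  by under eq_integral do rewrite abse_EFin.
by apply: filterS => x /(_ I) /= [].
Qed.

(** The sum of the absolute increments has a finite mean, hence is finite almost surely. *)
Lemma ae_cvg_increments (R : realType) d (T : measurableType d) (P : probability T R)
    (f : nat -> T -> measurableTypeR R) (a c : R) : 0 < c < 1 ->
  (forall n, measurable_fun setT (f n)) ->
  (forall n, (\int[P]_x (`|f n.+1 x - f n x|)%:E <= (a * c ^+ n)%:E)%E) ->
  {ae P, forall x, cvgn (fun n => f n x : R)}.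
Proof.
move=> c01 mf fa; pose D n x := `|f n.+1 x - f n x|.
have mD n : measurable_fun setT (fun x => (D n x)%:E) by exact: (measurable_dist (mf n.+1) (mf n)).
have D0 n x : (0 <= (D n x)%:E)%E by rewrite lee_fin /D.
have iD : P.-integrable setT (fun x => (\sum_(n <oo) (D n x)%:E)%E).
  apply/integrableP; split; first exact: ge0_emeasurable_sum.
  under eq_integral do rewrite gee0_abs ?nneseries_ge0 //.
  rewrite integral_nneseries //.
  apply: le_lt_trans (nneseries_geometric_lty a c01).
  by apply: lee_nneseries => [n _ _|n _]; [exact: integral_ge0|exact: fa].
apply: filterS (integrable_ae measurableT iD) => x /(_ I) sx.
have cD : cvgn (series (fun n => D n x)).
  apply: nnseries_is_cvg; first by move=> n; rewrite /D.
  by rewrite ltey_eq sx.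
have : cvgn (series (telescope (fun n => f n x : R))).
  by apply: normed_cvg; exact: cD.
rewrite telescopeK => h.
have -> : (fun n => f n x : R) = (fun n => (f n x - f 0%N x) + f 0%N x).
  by apply/funext => n; rewrite subrK.
by apply: is_cvgD => //; exact: is_cvg_cst.
Qed.

(** An upper limit with a default value is defined on every path, which makes the limit measurable
    and compatible with shifts without discarding a null set. *)
Definition limit_of (R : realType) (p q : nat) (A B : 'I_q -> 'M[R]_p) (b : 'cV[R]_p)
    x (t : int) : 'cV[R]_p :=
  \col_i fine (limn_esup (fun n => (picard A B b x n t i 0)%:E)).

Section existence.
Context (R : realType) d (T : measurableType d) (P : probability T R) (p q : nat).
Variables (A B : 'I_q -> 'M[R]_p) (b : 'cV[R]_p).
Variable N : int -> 'I_p -> {nonneg R} -> T -> nat.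
Hypothesis hN : iid_poisson P N.
Variables (w : 'I_p -> R) (c : R).
Hypothesis w0 : forall i, 0 < w i.
Hypothesis c01 : 0 < c < 1.
Hypothesis Gw : forall i,
  \sum_(l : 'I_q * 'I_p) (`|A l.1 i l.2| + `|B l.1 i l.2|) * w l.2 <= c * w i.
Variable K : R.
Hypothesis K0 : 0 <= K.

Let pic n x := picard A B b (path_of N x) n.
Let lim x := limit_of A B b (path_of N x).

Hypothesis picK : forall n t i, (\int[P]_x (`|pic n x t i 0|)%:E <= (K * w i)%:E)%E.

Let ppic n : predictable N (pic n).
Proof. exact: (picard_predictable A B b hN n). Qed.

Let mpic n t i : measurable_fun setT (fun x => pic n x t i 0 : measurableTypeR R).
Proof. exact: (predictable_measurable hN t i (ppic n)). Qed.

(** The iterate of rank 0 is null, so [picK] is the case [n = 0]; each application of the recursion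
    then gains a factor [c]. *)
Lemma picard_dist n m t i :
  (\int[P]_x (`|pic (n + m)%N x t i 0 - pic n x t i 0|)%:E <= (c ^+ n * K * w i)%:E)%E.
Proof.
elim: n t i => [|n IH] t i.
  rewrite add0n expr0 mul1r; apply: le_trans (picK m t i).
  rewrite le_eqVlt; apply/orP; left; apply/eqP; apply: eq_integral => x _.
  by rewrite [X in _ - X]mxE subr0.
have := step_contraction b hN w0 Gw (ppic (n + m)%N) (ppic n) IH t i.
by rewrite mulrA -exprS.
Qed.

Lemma picard_ae_cvg t i : {ae P, forall x, cvgn (fun n => pic n x t i 0)}.
Proof.
apply: (@ae_cvg_increments _ _ _ _ (fun n x => pic n x t i 0) (K * w i) c) => // n.
by have := picard_dist n 1 t i; rewrite addn1 -mulrA mulrC.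
Qed.

Lemma limit_of_cvg x t i : cvgn (fun n => pic n x t i 0) ->
  pic n x t i 0 @[n --> \oo] --> lim x t i 0.
Proof.
move=> cp; rewrite /lim /limit_of mxE.
suff -> : limn_esup (fun n => (picard A B b (path_of N x) n t i 0)%:E) =
  (limn (fun n => pic n x t i 0))%:E by [].
by apply: (cvg_limn_einf_sup _).2; apply: cvg_EFin => //; exact: nearW.
Qed.

Lemma limit_predictable : predictable N lim.
Proof.
move=> t i; rewrite /adapted; under eq_fun do rewrite mxE.
apply: (measurableT_comp (fine_measurable measurableT)).
apply: (@measurable_fun_limn_esup _ (g_sigma_algebraType (past_gen N (t - 1)))) => n.
by apply/measurable_EFinP; exact: ppic.
Qed.

Let mlim t i : measurable_fun setT (fun x => lim x t i 0 : measurableTypeR R).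
Proof. exact: (predictable_measurable hN t i limit_predictable). Qed.

(** Let [m] tend to infinity in [picard_dist], by Fatou's lemma. *)
Lemma limit_dist n t i :
  (\int[P]_x (`|lim x t i 0 - pic n x t i 0|)%:E <= (c ^+ n * K * w i)%:E)%E.
Proof.
pose D m x : \bar R := (`|pic (n + m)%N x t i 0 - pic n x t i 0|)%:E.
have mD m : measurable_fun setT (D m) by exact: measurable_dist.
have D0 m x : (0 <= D m x)%E by rewrite lee_fin.
apply: (@le_trans _ _ (\int[P]_x limn_einf (fun m => D m x))%E).
  apply: ae_ge0_le_integral => //.
  - exact: measurable_dist.
  - move=> x _; rewrite limn_einf_lim; apply: lime_ge; first exact: is_cvg_einfs.
    by apply: nearW => m; apply: le_ereal_inf_tmp => _ [k _ <-].
  - under eq_fun do rewrite -[limn_einf _]oppeK -limn_esupN.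
    by apply: measurableT_comp => //; apply: measurable_fun_limn_esup => m;
      exact: measurableT_comp.
  - apply: filterS (picard_ae_cvg t i) => x /limit_of_cvg cx _.
    rewrite (cvg_limn_einf_sup (l := (`|lim x t i 0 - pic n x t i 0|)%:E) _).1 //.
    apply: cvg_EFin; first exact: nearW.
    apply: cvg_norm; apply: cvgB; last exact: cvg_cst.
    have -> : (fun m => pic (n + m)%N x t i 0) = (fun m => pic (m + n)%N x t i 0).
      by apply/funext => m; rewrite addnC.
    by rewrite (cvg_shiftn n (fun m => pic m x t i 0)).
apply: le_trans (fatou P measurableT mD _) _ => //.
rewrite limn_einf_lim; apply: lime_le; first exact: is_cvg_einfs.
apply: nearW => m; apply: le_trans (picard_dist n m t i).
by apply: ereal_inf_lbound; exists m => /=.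
Qed.

(** Both sides are geometrically close in L1 to the iterate of rank [n + 1], for every [n]. *)
Lemma limit_fixpoint t i :
  {ae P, forall x, lim x t i 0 = step A B b (path_of N x) (lim x) t i 0}.
Proof.
have pS := step_predictable A B b hN limit_predictable.
have mS : measurable_fun setT (fun x => step_of A B b N lim x t i 0 : measurableTypeR R).
  exact: (predictable_measurable hN t i pS).
have mD : measurable_fun setT
    (fun x => lim x t i 0 - step_of A B b N lim x t i 0 : measurableTypeR R).
  by apply: measurable_funB; [exact: mlim|exact: mS].
have small n : (\int[P]_x (`|lim x t i 0 - step_of A B b N lim x t i 0|)%:E
    <= (2 * K * w i * c ^+ n)%:E)%E.
  have mS' : measurable_fun setT (fun x => step_of A B b N (pic n) x t i 0 : measurableTypeR R).
    exact: (mpic n.+1).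
  apply: (@le_trans _ _ (\int[P]_x ((`|lim x t i 0 - pic n.+1 x t i 0|)%:E +
      (`|step_of A B b N lim x t i 0 - step_of A B b N (pic n) x t i 0|)%:E))%E).
    apply: ge0_le_integral => //.
    - by apply: measurable_dist; [exact: mlim|exact: mS].
    - by apply: emeasurable_funD; apply: measurable_dist => //; exact: (mpic n.+1).
    - move=> x _; rewrite -EFinD lee_fin [X in _ <= _ + X]distrC.
      exact: ler_distD.
  rewrite ge0_integralD //; last 2 first.
  - by apply: measurable_dist => //; exact: (mpic n.+1).
  - exact: measurable_dist.
  apply: (@le_trans _ _ ((c ^+ n.+1 * K * w i)%:E + (c * (c ^+ n * K) * w i)%:E)%E).
    apply: leeD; first exact: limit_dist.
    by apply: (step_contraction b hN w0 Gw limit_predictable (ppic n)); exact: limit_dist.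
  have h : c * (c ^+ n * K * w i) <= 1 * (c ^+ n * K * w i).
    have /andP[c0 c1] := c01; rewrite ler_wpM2r ?(ltW c1) // !mulr_ge0 ?(ltW (w0 i)) //.
    by rewrite exprn_ge0 // ltW.
  by rewrite -EFinD lee_fin exprS; lra.
apply: filterS (ae_eq0_geometric c01 mD small) => x /eqP; rewrite subr_eq0 => /eqP; exact.
Qed.

Lemma limit_moment (Psi : R -> R) (C : R) : continuous Psi -> (forall v, 0 <= Psi v) ->
  (forall n t i, (\int[P]_x (Psi (`|pic n x t i 0| / w i))%:E <= C%:E)%E) ->
  forall t i, (\int[P]_x (Psi (`|lim x t i 0| / w i))%:E <= C%:E)%E.
Proof.
move=> cPsi Psi0 picC t i.
have mPsi : measurable_fun setT (Psi : measurableTypeR R -> measurableTypeR R).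
  exact: continuous_measurable_fun.
have mP (f : T -> measurableTypeR R) : measurable_fun setT f ->
    measurable_fun setT (fun x => (Psi (`|f x| / w i))%:E).
  move=> mf; apply/measurable_EFinP; apply: measurableT_comp mPsi _.
  by apply: measurable_funM => //; apply: measurableT_comp.
pose D m x : \bar R := (Psi (`|pic m x t i 0| / w i))%:E.
have mD m : measurable_fun setT (D m) by exact: (mP (fun x => pic m x t i 0)).
have D0 m x : (0 <= D m x)%E by rewrite lee_fin.
apply: (@le_trans _ _ (\int[P]_x limn_einf (fun m => D m x))%E).
  apply: ae_ge0_le_integral => //.
  - by move=> x _; rewrite lee_fin.
  - exact: (mP (fun x => lim x t i 0)).
  - move=> x _; rewrite limn_einf_lim; apply: lime_ge; first exact: is_cvg_einfs.
    by apply: nearW => m; apply: le_ereal_inf_tmp => _ [k _ <-].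
  - under eq_fun do rewrite -[limn_einf _]oppeK -limn_esupN.
    by apply: measurableT_comp => //; apply: measurable_fun_limn_esup => m;
      exact: measurableT_comp.
  - apply: filterS (picard_ae_cvg t i) => x /limit_of_cvg cx _.
    rewrite (cvg_limn_einf_sup (l := (Psi (`|lim x t i 0| / w i))%:E) _).1 //.
    apply: cvg_EFin; first exact: nearW.
    apply: (@cvg_comp _ _ _ _ Psi _ _ _ _ (cPsi _)).
    by apply: cvgMl; exact: cvg_norm.
apply: le_trans (fatou P measurableT mD _) _ => //.
rewrite limn_einf_lim; apply: lime_le; first exact: is_cvg_einfs.
apply: nearW => m; apply: le_trans (picC m t i).
by apply: ereal_inf_lbound; exists m => /=.
Qed.

End existence.

(** * Invariance of the noise under time shifts, and stationarity *)

Lemma sigma_of_preimage (U I : Type) d (V : measurableType d) (X : I -> U -> V)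
    (C : set (I -> V)) :
  sigma_of (fun i (x : I -> V) => x i) C -> sigma_of X [set u | C (X ^~ u)].
Proof.
pose H : set (set (I -> V)) := [set C | sigma_of X [set u | C (X ^~ u)]].
suff : sigma_of (fun i (x : I -> V) => x i) `<=` H by exact.
apply: smallest_sub.
  split; first exact: sigma_algebra0.
    by move=> D HD; exact: (sigma_algebraCD HD).
  move=> F HF; rewrite /H /=.
  have -> : [set u | (\bigcup_i F i) (X ^~ u)] = \bigcup_i [set u | F i (X ^~ u)] by [].
  exact: sigma_algebra_bigcup.
move=> _ [i _ [D mD <-]]; apply: sub_sigma_algebra; exists i => //; exists D => //.
Qed.

Lemma sigma_of_sub (I : Type) d (T : measurableType d) d' (V : measurableType d')
    (X : I -> T -> V) :
  (forall i, measurable_fun setT (X i)) -> sigma_of X `<=` measurable.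
Proof.
move=> mX; apply: smallest_sub; first exact: sigma_algebra_measurable.
by move=> _ [i _ [D mD <-]]; exact: mX.
Qed.

Section shift.
Context (R : realType) d (T : measurableType d) (P : probability T R) (p : nat).
Variable N : int -> 'I_p -> {nonneg R} -> T -> nat.
Hypothesis hN : iid_poisson P N.
Variable h : int.

(* Both the noise and its shift live on [bool * T], read off the copies [true] and [false]
   of [T]; a functional of the noise then need not be defined on irregular paths. *)
Definition shifted (s : int) (i : 'I_p) (l : {nonneg R}) (z : bool * T) : nat :=
  N (if z.1 then s + h else s) i l z.2.

Let noise_events (s : int) : set (set (bool * T)) :=
  [set [set z | C (uncurry (shifted s) ^~ z)] | C in
    sigma_of (fun k (x : 'I_p * {nonneg R} -> nat) => x k)].

Let Tsh := g_sigma_algebraType (\bigcup_(s in [set: int]) noise_events s).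

Let noise_eventsI s : setI_closed (noise_events s).
Proof.
move=> _ _ [C sC <-] [D sD <-]; exists (C `&` D) => //.
rewrite -[C]setCK -[D]setCK -setCU -!setTD.
apply: sigma_algebraCD.
rewrite -bigcup2E; apply: sigma_algebra_bigcup => -[|[|n]] /=.
- exact: (sigma_algebraCD sC).
- exact: (sigma_algebraCD sD).
- exact: sigma_algebra0.
Qed.

Let noise_eventsT s : noise_events s setT.
Proof.
by exists setT => //; rewrite -[setT]setD0; apply: sigma_algebraCD; exact: sigma_algebra0.
Qed.

Let noise_measurable s C : sigma_of (fun k (x : 'I_p * {nonneg R} -> nat) => x k) C ->
  <<s law_gen N s >> [set v | C (uncurry (N s) ^~ v)].
Proof. by move=> sC; exact: (sigma_of_preimage (X := uncurry (N s)) sC). Qed.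

Let uncurry_shifted s e v :
  uncurry (shifted s) ^~ (e, v) = uncurry (N (if e then s + h else s)) ^~ v.
Proof. by apply/funext => -[]. Qed.

Let measurable_copy (e : bool) : measurable_fun setT (fun v : T => (e, v) : Tsh).
Proof.
apply: (@measurability _ _ T Tsh setT _ (\bigcup_(s in [set: int]) noise_events s)) => //.
move=> _ [_ [s _ [C sC <-]] <-]; rewrite setTI.
have -> : (fun v : T => (e, v)) @^-1` [set z | C (uncurry (shifted s) ^~ z)] =
    [set v | C (uncurry (N (if e then s + h else s)) ^~ v)].
  by apply/seteqP; split=> v /=; rewrite uncurry_shifted.
exact: (law_gen_sub hN (noise_measurable sC)).
Qed.

(** The two copies push [P] to two measures on [bool * T]; by uniqueness it suffices to compare them
    on cylinders. *)
Lemma shift_law (E : set (bool * T)) : @measurable _ Tsh E ->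
  P [set v | E (true, v)] = P [set v | E (false, v)].
Proof.
move=> mE.
pose m (e : bool) := pushforward P (fun v : T => (e, v) : Tsh).
have mfin (e : bool) : (pushforward P (fun v : T => (e, v) : Tsh) setT < +oo)%E.
  by rewrite /pushforward preimage_setT probability_setT ltry.
rewrite -[LHS]/(pushforward P (fun v : T => (true, v) : Tsh) E).
rewrite -[RHS]/(pushforward P (fun v : T => (false, v) : Tsh) E).
apply: (@cylinders_unique _ Tsh R int noise_events setT _ _ _ _ _ _ _ E) => //=.
- by move=> s _ A sA; apply: sub_sigma_algebra; exists s.
move=> _ [J [A [_ FA ->]]].
have {}FA s : exists C, sigma_of (fun k (x : 'I_p * {nonneg R} -> nat) => x k) C /\
    [set z | C (uncurry (shifted s) ^~ z)] = A s.
  by have [C sC CA] := FA s I; exists C.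
have [C CP] := choice FA.
(* The right-hand side does not depend on [k]: independence factors the event and equality of laws
   brings each factor back to time [s]. It is used at [k = h] and [k = 0]. *)
have prob (k : int) : P (\bigcap_(s in [set` J]) [set v | C s (uncurry (N (s + k)) ^~ v)]) =
    (\prod_(s <- undup J) P [set v | C s (uncurry (N s) ^~ v)])%E.
  transitivity (P (\bigcap_(r in [set` map (+%R^~ k) (undup J)])
      [set v | C (r - k) (uncurry (N r) ^~ v)])).
    congr (P _); apply/seteqP; split=> v vJ.
      by move=> _ /mapP [s + ->]; rewrite mem_undup addrK => /vJ.
    move=> s sJ; have := vJ (s + k); rewrite /= addrK; apply.
    by apply: (map_f (+%R^~ k)); rewrite mem_undup.
  rewrite hN.1.1; first last.
  - by move=> r _; apply: noise_measurable; exact: (CP _).1.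
  - by rewrite map_inj_uniq ?undup_uniq //; exact: addIr.
  rewrite big_map; apply: eq_bigr => s _; rewrite addrK.
  exact: hN.1.2 (CP s).1.
rewrite /pushforward.
have -> : (fun v : T => (true, v)) @^-1` (\bigcap_(i in [set` J]) A i) =
    \bigcap_(s in [set` J]) [set v | C s (uncurry (N (s + h)) ^~ v)].
  by apply/seteqP; split=> v vA s /vA; rewrite -(CP s).2 /= uncurry_shifted.
have -> : (fun v : T => (false, v)) @^-1` (\bigcap_(i in [set` J]) A i) =
    \bigcap_(s in [set` J]) [set v | C s (uncurry (N (s + 0)) ^~ v)].
  by apply/seteqP; split=> v vA s /vA; rewrite -(CP s).2 /= uncurry_shifted addr0.
by rewrite !prob.
Qed.

Lemma shifted_rcont s i z : rcont_path (path_of shifted z s i).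
Proof. exact: (rcont_path_of hN). Qed.

Lemma shifted_measurable s i l : measurable_fun [set: Tsh] (shifted s i l).
Proof.
move=> _ D mD; rewrite setTI; apply: sub_sigma_algebra; exists s => //.
exists [set x | D (x (i, l))] => //; apply: sub_sigma_algebra.
by exists (i, l) => //; exists D => //; rewrite setTI.
Qed.

Variables (q : nat) (A B : 'I_q -> 'M[R]_p) (b : 'cV[R]_p).

Let lim x := limit_of A B b x.

Lemma limit_shift x t : lim (fun s => x (s + h)) t = lim x (t + h).
Proof.
apply/colP => i; rewrite !mxE; congr (fine (limn_esup _)).
by apply/funext => n; rewrite picard_shift.
Qed.

End shift.

Lemma constructed_stationary (R : realType) d (T : measurableType d) (P : probability T R)
    (p q : nat) (N : int -> 'I_p -> {nonneg R} -> T -> nat) (A B : 'I_q -> 'M[R]_p)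
    (b : 'cV[R]_p) : iid_poisson P N ->
  stationary P (fun t v => counts (path_of N v) (limit_of A B b (path_of N v)) t)
               (fun t v => limit_of A B b (path_of N v) t).
Proof.
move=> hN h D sD.
pose S := shifted N h.
pose J (k : int * 'I_p) (z : bool * T) : nat * measurableTypeR R :=
  (counts (path_of S z) (limit_of A B b (path_of S z)) k.1 k.2 0,
   limit_of A B b (path_of S z) k.1 k.2 0).
pose Gn (s : int) : set (set (bool * T)) :=
  [set [set z | C (uncurry (S s) ^~ z)] | C in
    sigma_of (fun k (x : 'I_p * {nonneg R} -> nat) => x k)].
pose Tsh := g_sigma_algebraType (\bigcup_(s in [set: int]) Gn s).
have mlim t i : measurable_fun [set: Tsh]
    (fun z => limit_of A B b (path_of S z) t i 0 : measurableTypeR R).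
  have -> : (fun z => limit_of A B b (path_of S z) t i 0 : measurableTypeR R) =
      (fun z => fine (limn_esup (fun n => (picard A B b (path_of S z) n t i 0)%:E))).
    by apply/funext => z; rewrite mxE.
  apply: (measurableT_comp (fine_measurable measurableT)).
  apply: measurable_fun_limn_esup => n; apply/measurable_EFinP.
  apply: (@measurable_picard _ _ _ _ _ _ _ Tsh S) => [u k z|u k l _].
    exact: (shifted_rcont hN).
  exact: (shifted_measurable (N := N) (h := h)).
have mJ k : measurable_fun [set: Tsh] (J k).
  apply: measurable_fun_pair => //.
  apply: (@measurable_counts _ _ _ Tsh S) => // [u j z|l].
    exact: (shifted_rcont hN).
  exact: (shifted_measurable (N := N) (h := h)).
have mD : @measurable _ Tsh [set z | D (J ^~ z)].
  by apply: (sigma_of_sub (T := Tsh) mJ); exact: sigma_of_preimage.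
(* On the copy [true] the noise is shifted by [h], and the construction commutes with shifts. *)
have eT v : (J ^~ (true, v)) = (fun k => joint (fun t v => counts (path_of N v)
    (limit_of A B b (path_of N v)) t) (fun t v => limit_of A B b (path_of N v) t)
    (k.1 + h, k.2) v).
  apply/funext => k; rewrite /J /joint /=.
  have -> : path_of S (true, v) = (fun s => path_of N v (s + h)) by [].
  rewrite -counts_shift limit_shift; congr (counts _ _ _ _ _, _).
  by apply/funext => s; rewrite limit_shift.
have := shift_law hN (h := h) mD; rewrite /=.
under eq_set do rewrite eT.
by move=> ->.
Qed.

(** * Uniqueness *)

Lemma ae_forall_int (R : realType) d (T : measurableType d) (P : probability T R)
    (Q : int -> T -> Prop) :
  (forall t, {ae P, forall v, Q t v}) -> {ae P, forall v, forall t, Q t v}.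
Proof.
move=> aeQ; have h1 := ae_foralln (fun n => aeQ (Posz n)).
have h2 := ae_foralln (fun n => aeQ (Negz n)).
apply: filterS2 h1 h2 => v h1 h2 [n|n]; [exact: h1|exact: h2].
Qed.

(** Bernoulli's inequality for [g = 1 - (1 - c) / (q + 1)]. *)
Lemma geometric_rate (R : realType) (q : nat) (c : R) : 0 < c < 1 ->
  exists2 g : R, 0 < g < 1 & c <= g ^+ q.
Proof.
move=> /andP[c0 c1]; pose x := (1 - c) / q.+1%:R.
have q0 : 0 < q.+1%:R :> R by rewrite ltr0n.
have x0 : 0 < x by rewrite divr_gt0 // subr_gt0.
have x1 : x <= 1 - c by rewrite ler_pdivrMr // ler_peMr ?ler1n // subr_ge0 ltW.
exists (1 - x); first by rewrite gtrBl x0 andbT; lra.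
have bern n : 1 - n%:R * x <= (1 - x) ^+ n.
  elim: n => [|n IH]; first by rewrite mul0r subr0 expr0.
  rewrite exprS; have h : (1 - x) * (1 - n%:R * x) <= (1 - x) * (1 - x) ^+ n.
    by apply: ler_wpM2l => //; lra.
  apply: le_trans h; rewrite -natr1; have := sqr_ge0 x; have : 0 <= n%:R :> R by [].
  nra.
apply: le_trans (bern q); have : q%:R * x <= 1 - c; last lra.
by rewrite /x mulrA ler_pdivrMr // mulrC ler_wpM2l ?subr_ge0 ?(ltW c1) // ler_nat.
Qed.

Section regular.
Context (R : realType) d (T : measurableType d) (P : probability T R) (p q : nat).
Variables (A B : 'I_q -> 'M[R]_p) (b : 'cV[R]_p).
Variable N : int -> 'I_p -> {nonneg R} -> T -> nat.
Hypothesis hN : iid_poisson P N.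
Variables (Y : int -> T -> 'cV[nat]_p) (mu : int -> T -> 'cV[R]_p).
Hypothesis reg : regular_solution P A B b N Y mu.

Lemma joint_adapted t i :
  measurable_fun [set: g_sigma_algebraType (past_gen N t)] (joint Y mu (t, i)).
Proof.
case: reg => _ _ na _; apply/measurable_fun_g_sigma => D mD.
apply: (na t); apply: sub_sigma_algebra; exists i => //; exists D => //.
by rewrite setTI.
Qed.

Lemma intensity_adapted t i : adapted N t (fun v => mu t v i 0).
Proof. exact: ((measurable_fun_pairP _).1 (@joint_adapted t i)).2. Qed.

Lemma solution_count_adapted t i :
  measurable_fun [set: g_sigma_algebraType (past_gen N t)] (fun v => Y t v i 0).
Proof. exact: ((measurable_fun_pairP _).1 (@joint_adapted t i)).1. Qed.

Lemma joint_measurable t i : measurable_fun [set: T] (joint Y mu (t, i)).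
Proof.
apply: (measurable_fun_sub_sigma (@past_gen_sub _ _ _ _ _ _ hN t)); exact: joint_adapted.
Qed.

Lemma intensity_measurable t i : measurable_fun setT (fun v => mu t v i 0 : measurableTypeR R).
Proof. exact: ((measurable_fun_pairP _).1 (@joint_measurable t i)).2. Qed.

Lemma solution_count_measurable t i : measurable_fun setT (fun v => Y t v i 0).
Proof. exact: ((measurable_fun_pairP _).1 (@joint_measurable t i)).1. Qed.

Lemma stationary_integral t i (g : nat * measurableTypeR R -> \bar R) :
  measurable_fun setT g -> (forall x, 0 <= g x)%E ->
  (\int[P]_v g (joint Y mu (t, i) v) = \int[P]_v g (joint Y mu (0%R, i) v))%E.
Proof.
move=> mg g0; have mt := @joint_measurable t i; have m0 := @joint_measurable 0 i.
have -> : (\int[P]_v g (joint Y mu (t, i) v) = \int[pushforward P (joint Y mu (t, i))]_y g y)%E.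
  by rewrite ge0_integral_pushforward.
have -> : (\int[P]_v g (joint Y mu (0%R, i) v) = \int[pushforward P (joint Y mu (0%R, i))]_y g y)%E.
  by rewrite ge0_integral_pushforward.
apply: eq_measure_integral => D mD _.
case: reg => _ st _ _.
have := st t [set x | D (x (0, i))]; rewrite /= add0r; apply.
apply: sub_sigma_algebra; exists (0, i) => //; exists D => //.
by rewrite setTI.
Qed.

(** Non-anticipation makes [mu t] measurable only for the past up to [t], whereas freezing requires
    [t - 1]. The right-hand side of the recursion is a predictable version of [mu]. *)
Definition predictor (v : T) : int -> 'cV[R]_p :=
  regression A B b (fun s => mu s v) (fun s => Y s v).

Lemma predictor_predictable : predictable N predictor.
Proof.
move=> t i; apply: (@measurable_regression _ _ _ _ _ _ _
  (g_sigma_algebraType (past_gen N (t - 1))) (fun v s => mu s v) (fun v s => Y s v) t i)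
  => s k st; have st1 : s <= t - 1 by rewrite lerBrDr lezD1.
  by apply: adapted_mono st1 _; exact: intensity_adapted.
have := @solution_count_adapted s k => /measurable_fun_g_sigma h.
apply/measurable_fun_g_sigma => D mD.
by apply: sub_sigma_algebra2 (h D mD); exact: past_gen_mono.
Qed.

Lemma solution_ae : {ae P, forall v, forall t,
  [/\ mu t v = predictor v t, Y t v = counts (path_of N v) (predictor v) t &
      predictor v t = step_of A B b N predictor v t]}.
Proof.
case: reg => sol _ _ _; apply: filterS (ae_forall_int sol) => v solv.
have muE t : mu t v = predictor v t by have [] := solv t.
have YE t : Y t v = counts (path_of N v) (predictor v) t.
  have [-> _] := solv t; apply/colP => i; rewrite [LHS]mxE [RHS]mxE /at_exp -muE.
  by congr (N t i _ v); rewrite mxE.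
move=> t; split => //; rewrite {1}/predictor /step_of /step.
by congr (regression _ _ _ _ _ t); apply/funext => s.
Qed.

(** Integrability gives a finite mean at time 0, stationarity carries it to all times. *)
Lemma solution_count_mean : exists2 m : R, 0 <= m & forall t i,
  (\int[P]_v (Y t v i 0)%:R%:E <= m%:E)%E.
Proof.
case: reg => _ _ _ int.
have mY t i : measurable_fun setT (fun v => (Y t v i 0)%:R%:E : \bar R).
  exact: (measurable_fun_nat2 (fun a _ : nat => a%:R%:E : \bar R)
    (@solution_count_measurable t i) (@solution_count_measurable t i)).
have := int 0; rewrite /finite_mean unlock => fin.
pose m := (\int[P]_v (norm1 (real_vec (Y 0 v)) : R)%:E)%E.
have m0 : (0 <= m)%E by apply: integral_ge0 => v _; rewrite lee_fin sumr_ge0.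
have mfin : m \is a fin_num by rewrite ge0_fin_numE.
exists (fine m); first exact: fine_ge0.
move=> t i; rewrite fineK //.
pose g (x : nat * measurableTypeR R) : \bar R := x.1%:R%:E.
have mg : measurable_fun setT g.
  exact: (measurable_fun_nat2 (fun a _ : nat => a%:R%:E : \bar R) measurable_fst measurable_fst).
rewrite (_ : (\int[P]_v (Y t v i 0)%:R%:E)%E = (\int[P]_v g (joint Y mu (t, i) v))%E) //.
rewrite stationary_integral //; last by move=> x; rewrite lee_fin.
apply: ge0_le_integral => //.
- by move=> v _; rewrite lee_fin.
- exact: (mY 0 i).
- apply/measurable_EFinP.
  rewrite (_ : (fun v => _) = (fun v => \sum_k (Y 0 v k 0)%:R : R)); last first.
    by apply/funext => v; apply: eq_bigr => k _; rewrite mxE ger0_norm.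
  by apply: measurable_sum => k; apply/measurable_EFinP; exact: mY.
- move=> v _; rewrite /g /joint /= lee_fin /norm1 (bigD1 i) //= mxE ger0_norm //.
  by rewrite lerDl sumr_ge0.
Qed.

End regular.

(** * Integrability of the log-intensity of a given solution *)

Lemma ge0_minD (R : realType) (x y L : R) : 0 <= x -> 0 <= y -> 0 <= L ->
  Num.min (x + y) L <= Num.min x L + Num.min y L.
Proof.
move=> x0 y0 L0; rewrite !minEle.
by case: ifP; case: ifP; case: ifP => // /negP/negP; rewrite -?ltNge; lra.
Qed.

Lemma ge0_min_sum (R : realType) (I : Type) (r : seq I) (f : I -> R) (L : R) :
  (forall l, 0 <= f l) -> 0 <= L ->
  Num.min (\sum_(l <- r) f l) L <= \sum_(l <- r) Num.min (f l) L.
Proof.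
move=> f0 L0; elim: r => [|l r IH]; first by rewrite !big_nil minEle L0.
by rewrite !big_cons; apply: le_trans (ge0_minD _ _ _) _; rewrite ?sumr_ge0 ?lerD2l.
Qed.

Section backward_iteration.
Variables (R : realType) (p q : nat) (A B : 'I_q -> 'M[R]_p) (b : 'cV[R]_p).
Variables (w : 'I_p -> R) (c g : R).
Hypothesis w0 : forall i, 0 < w i.
Hypothesis g01 : 0 < g < 1.
Hypothesis cg : c <= g ^+ q.
Hypothesis Gw : forall i,
  \sum_(l : 'I_q * 'I_p) (`|A l.1 i l.2| + `|B l.1 i l.2|) * w l.2 <= c * w i.

(** Bounds the part of the recursion driven by the constant and the counts, through
    [ln (1 + y) <= y]; its mean is finite as soon as the counts are integrable. *)
Definition input (y : int -> 'cV[nat]_p) (t : int) : R :=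
  \sum_i (`|b i 0| + \sum_(l : 'I_q * 'I_p)
            `|B l.1 i l.2| * (y (t - l.1.+1%:Z) l.2 0)%:R) / w i.

(** The sum over [m < n] of [g ^ m] times the input at time [t - m]. *)
Fixpoint discounted_input (y : int -> 'cV[nat]_p) (n : nat) (t : int) : R :=
  if n is m.+1 then g * discounted_input y m (t - 1) + input y t else 0.

(** Lags run here from 0 to [q - 1]: this is the size of the state of the recursion rewritten as one
    of order 1. *)
Definition lag_norm (u : int -> 'cV[R]_p) (t : int) : R :=
  \sum_(l : 'I_q * 'I_p) `|u (t - l.1%:Z) l.2 0| / w l.2.

Lemma input_ge0 y t : 0 <= input y t.
Proof.
apply: sumr_ge0 => i _; rewrite divr_ge0 ?(ltW (w0 i)) // addr_ge0 //.
by apply: sumr_ge0 => l _; rewrite mulr_ge0.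
Qed.

Lemma discounted_input_ge0 y n t : 0 <= discounted_input y n t.
Proof.
have /andP[g0 _] := g01.
elim: n t => [|n IH] t //=; rewrite addr_ge0 ?input_ge0 //.
by rewrite mulr_ge0 ?IH // ltW.
Qed.

Lemma lag_norm_ge0 u t : 0 <= lag_norm u t.
Proof. by apply: sumr_ge0 => l _; rewrite divr_ge0 // ltW. Qed.

Variables (u : int -> 'cV[R]_p) (y : int -> 'cV[nat]_p).
Hypothesis uE : forall t, u t = regression A B b u y t.

(* Discounting lag [j] by [g ^ j], with [c <= g ^ q], makes the recursion of order [q] a
   one-step contraction of rate [g]. *)
Lemma lag_step t (M : R) : 0 <= M ->
  (forall (j : nat) i, (j < q)%N -> g ^+ j * `|u (t - 1 - j%:Z) i 0| <= M * w i) ->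
  forall (j : nat) i, (j < q)%N ->
    g ^+ j * `|u (t - j%:Z) i 0| <= (g * M + input y t) * w i.
Proof.
have /andP[g0 g1] := g01.
move=> M0 HM [|j] i jq; last first.
  apply: (@le_trans _ _ (g * (M * w i))).
    rewrite exprS -mulrA; apply: ler_wpM2l; first exact: ltW.
    have -> : t - j.+1%:Z = t - 1 - j%:Z by rewrite intS opprD addrA.
    by apply: HM; exact: ltnW.
  by rewrite mulrDl -mulrA lerDl mulr_ge0 ?input_ge0 // ltW.
rewrite expr0 mul1r subr0 uE regressionE.
apply: le_trans (ler_normD _ _) _.
have hA : \sum_(l : 'I_q * 'I_p) `|A l.1 i l.2| * `|u (t - l.1.+1%:Z) l.2 0| <= g * M * w i.
  (* After multiplication by [g ^ (q - 1)], which is at most [g ^ j] for [j < q], the hypothesis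
     [HM] bounds each lag; what remains is [c <= g ^ q]. *)
  have gq : 0 < g ^+ q.-1 by rewrite exprn_gt0.
  rewrite -(ler_pM2l gq) mulr_sumr.
  apply: (@le_trans _ _ (\sum_(l : 'I_q * 'I_p) (`|A l.1 i l.2| + `|B l.1 i l.2|) * w l.2 * M)).
    apply: ler_sum => -[j k] _ /=.
    rewrite mulrCA -mulrA mulrDl.
    apply: (@le_trans _ _ (`|A j i k| * (w k * M))).
      apply: ler_wpM2l => //; rewrite [leRHS]mulrC.
      have -> : t - j.+1%:Z = t - 1 - j%:Z by rewrite intS opprD addrA.
      apply: le_trans (HM j k (ltn_ord j)); apply: ler_wpM2r => //.
      apply: ler_wiXn2l; rewrite ?(ltW g0) ?(ltW g1) //.
      by rewrite -ltnS prednK // (leq_trans _ jq).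
    by rewrite lerDl !mulr_ge0 // ltW.
  rewrite -mulr_suml; apply: (@le_trans _ _ (c * w i * M)).
    by apply: ler_wpM2r => //; exact: Gw.
  rewrite [g * M]mulrC !mulrA [g ^+ _ * M]mulrC -!mulrA [w i * M]mulrC mulrCA.
  apply: ler_wpM2l => //; rewrite mulrA -exprSr prednK //.
  by rewrite ler_wpM2r // ltW.
have hB : `|b i 0| + \sum_(l : 'I_q * 'I_p) `|B l.1 i l.2| *
    `|ln (1 + (y (t - l.1.+1%:Z) l.2 0)%:R)| <= input y t * w i.
  apply: (@le_trans _ _ (`|b i 0| + \sum_(l : 'I_q * 'I_p)
            `|B l.1 i l.2| * (y (t - l.1.+1%:Z) l.2 0)%:R)).
    rewrite lerD2l; apply: ler_sum => l _; apply: ler_wpM2l => //.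
    rewrite ger0_norm; last by rewrite ln_ge0 // lerDl.
    by apply: le_ln1Dx; apply: lt_le_trans (ler0n _ _); rewrite ltrN10.
  rewrite -ler_pdivrMr // /input (bigD1 i) //= lerDl sumr_ge0 // => k _.
  rewrite divr_ge0 ?(ltW (w0 k)) // addr_ge0 //.
  by apply: sumr_ge0 => l _; rewrite mulr_ge0.
rewrite mulrDl; apply: le_trans (lerD hA hB).
rewrite addrCA lerD2l; apply: le_trans (ler_norm_sum _ _ _) _.
rewrite -big_split /=; apply: ler_sum => l _.
by rewrite -!normrM; exact: ler_normD.
Qed.

Lemma lag_iterate n t (j : nat) i : (j < q)%N ->
  g ^+ j * `|u (t - j%:Z) i 0| <=
  (g ^+ n * lag_norm u (t - n%:Z) + discounted_input y n t) * w i.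
Proof.
have /andP[g0 g1] := g01.
elim: n t j i => [|n IH] t j i jq.
  rewrite expr0 mul1r subr0 addr0.
  apply: (@le_trans _ _ `|u (t - j%:Z) i 0|).
    by rewrite ler_piMl // exprn_ile1 // ltW.
  rewrite -ler_pdivrMr // /lag_norm (bigD1 (Ordinal jq, i)) //= lerDl.
  by apply: sumr_ge0 => l _; rewrite divr_ge0 // ltW.
have M0 : 0 <= g ^+ n * lag_norm u (t - 1 - n%:Z) + discounted_input y n (t - 1).
  by rewrite addr_ge0 ?discounted_input_ge0 // mulr_ge0 ?lag_norm_ge0 // exprn_ge0 // ltW.
have := lag_step M0 (fun j i jq => IH (t - 1) j i jq) i jq.
have -> : t - n.+1%:Z = t - 1 - n%:Z by rewrite intS opprD addrA.
by rewrite mulrDr mulrA -exprS addrA.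
Qed.

End backward_iteration.

Lemma integral_affine_le (R : realType) d (T : measurableType d) (P : probability T R)
    (I : finType) (k m : R) (a : I -> R) (f : I -> T -> measurableTypeR R) :
  0 <= k -> (forall l, 0 <= a l) -> (forall l x, 0 <= f l x) ->
  (forall l, measurable_fun setT (f l)) ->
  (forall l, (\int[P]_x (f l x)%:E <= m%:E)%E) ->
  (\int[P]_x (k + \sum_l a l * f l x)%:E <= (k + \sum_l a l * m)%:E)%E.
Proof.
move=> k0 a0 f0 mf fm.
have mf' l : measurable_fun setT (fun x => (f l x)%:E) by apply/measurable_EFinP; exact: mf.
have E1 x : (k + \sum_l a l * f l x)%:E = (cst k%:E x + \sum_l (a l)%:E * (f l x)%:E)%E.
  by rewrite EFinD -sumEFin.
under eq_integral do rewrite E1.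
have af0 l x : (0 <= (a l)%:E * (f l x)%:E)%E by rewrite mule_ge0 // lee_fin.
have maf l : measurable_fun setT (fun x => (a l)%:E * (f l x)%:E)%E by exact: measurable_funeM.
rewrite ge0_integralD //; last 2 first.
- by move=> x _; apply: sume_ge0.
- exact: emeasurable_sum.
rewrite integral_cst_prob EFinD leeD2l // ge0_integral_sum // -sumEFin.
apply: lee_sum => l _; rewrite ge0_integralZl_EFin //; last by move=> x _; rewrite lee_fin.
by rewrite EFinM; apply: lee_wpmul2l; rewrite ?lee_fin.
Qed.

Section solution_L1.
Context (R : realType) d (T : measurableType d) (P : probability T R) (p q : nat).
Variables (A B : 'I_q -> 'M[R]_p) (b : 'cV[R]_p).
Variable N : int -> 'I_p -> {nonneg R} -> T -> nat.
Hypothesis hN : iid_poisson P N.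
Hypothesis q0 : (0 < q)%N.
Variables (w : 'I_p -> R) (c : R).
Hypothesis w0 : forall i, 0 < w i.
Hypothesis c01 : 0 < c < 1.
Hypothesis Gw : forall i,
  \sum_(l : 'I_q * 'I_p) (`|A l.1 i l.2| + `|B l.1 i l.2|) * w l.2 <= c * w i.
Variables (Y : int -> T -> 'cV[nat]_p) (mu : int -> T -> 'cV[R]_p).
Hypothesis reg : regular_solution P A B b N Y mu.

Let y v s := Y s v.

Let mmu t i : measurable_fun setT (fun v => mu t v i 0 : measurableTypeR R).
Proof. exact: (intensity_measurable hN reg). Qed.

Let mY t i : measurable_fun setT (fun v => (Y t v i 0)%:R : measurableTypeR R).
Proof.
have h := solution_count_measurable hN reg t i.
exact: (measurable_fun_nat2 (fun a _ : nat => a%:R : measurableTypeR R) h h).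
Qed.

Let inputE v t : input B b w (y v) t = \sum_i `|b i 0| / w i +
  \sum_(r : 'I_p * ('I_q * 'I_p))
    (`|B r.2.1 r.1 r.2.2| / w r.1) * (Y (t - r.2.1.+1%:Z) v r.2.2 0)%:R.
Proof.
rewrite /input -(pair_bigA _ (fun i (l : 'I_q * 'I_p) =>
  (`|B l.1 i l.2| / w i) * (Y (t - l.1.+1%:Z) v l.2 0)%:R)) -big_split /=.
apply: eq_bigr => i _; rewrite mulrDl mulr_suml; congr (_ + _).
by apply: eq_bigr => l _; rewrite mulrAC.
Qed.

Let minput t : measurable_fun setT (fun v => input B b w (y v) t : measurableTypeR R).
Proof.
under eq_fun do rewrite inputE.
apply: measurable_funD => //; apply: measurable_sum => r.
by apply: measurable_funM => //; exact: mY.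
Qed.

Lemma discounted_input_mean (g : R) : 0 < g < 1 -> exists2 C, 0 <= C &
  forall n t, measurable_fun setT (fun v => (discounted_input B b w g (y v) n t)%:E) /\
    (\int[P]_v (discounted_input B b w g (y v) n t)%:E <= C%:E)%E.
Proof.
move=> /andP[g0 g1]; have [m m0 Ym] := solution_count_mean hN reg.
pose X := \sum_i `|b i 0| / w i + \sum_(r : 'I_p * ('I_q * 'I_p))
  (`|B r.2.1 r.1 r.2.2| / w r.1) * m.
have k0 : 0 <= \sum_i `|b i 0| / w i.
  by apply: sumr_ge0 => i _; rewrite divr_ge0 // ltW.
have a0 (r : 'I_p * ('I_q * 'I_p)) : 0 <= `|B r.2.1 r.1 r.2.2| / w r.1.
  by rewrite divr_ge0 // ltW.
have X0 : 0 <= X by rewrite addr_ge0 //; apply: sumr_ge0 => r _; rewrite mulr_ge0.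
have inX t : (\int[P]_v (input B b w (y v) t)%:E <= X%:E)%E.
  under eq_integral do rewrite inputE.
  by apply: integral_affine_le.
(* The bound is the fixed point of [C = g * C + X]. *)
have C0 : 0 <= X / (1 - g) by rewrite divr_ge0 // subr_ge0 ltW.
exists (X / (1 - g)) => //.
elim=> [|n IH] t /=.
  by split; [exact: measurable_cst|rewrite integral0 lee_fin].
have [mD ID] := IH (t - 1).
have mI : measurable_fun setT (fun v => (input B b w (y v) t)%:E).
  by apply/measurable_EFinP; exact: minput.
have E1 v : (g * discounted_input B b w g (y v) n (t - 1) + input B b w (y v) t)%:E =
    (g%:E * (discounted_input B b w g (y v) n (t - 1))%:E + (input B b w (y v) t)%:E)%E.
  by rewrite EFinD EFinM.
split.
  by under eq_fun do rewrite E1; apply: emeasurable_funD => //; exact: measurable_funeM.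
under eq_integral do rewrite E1.
have D0 v : (0 <= (discounted_input B b w g (y v) n (t - 1))%:E)%E.
  by rewrite lee_fin discounted_input_ge0 // g0.
rewrite ge0_integralD //; last 3 first.
- by move=> v _; rewrite mule_ge0 // lee_fin ltW.
- exact: measurable_funeM.
- by move=> v _; rewrite lee_fin input_ge0.
rewrite ge0_integralZl_EFin ?(ltW g0) //.
apply: (@le_trans _ _ (g%:E * (X / (1 - g))%:E + X%:E)%E).
  by apply: leeD => //; apply: lee_wpmul2l => //; rewrite lee_fin ltW.
rewrite -EFinM -EFinD lee_fin le_eqVlt; apply/orP; left; apply/eqP.
by field; rewrite subr_eq0 gt_eqF.
Qed.

(** At this stage [mu 0] is only known to be finite; truncation at [L] supplies the domination. *)
Lemma truncated_lags_cvg (g L : R) : 0 < g < 1 -> 0 <= L ->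
  (\int[P]_v (\sum_(l : 'I_q * 'I_p) Num.min (g ^+ n * (`|mu 0 v l.2 0| / w l.2)) L)%:E)%E
    @[n --> \oo] --> (0 : \bar R)%E.
Proof.
move=> /andP[g0 g1] L0.
have mterm n (l : 'I_q * 'I_p) : measurable_fun setT
    (fun v => Num.min (g ^+ n * (`|mu 0 v l.2 0| / w l.2)) L : measurableTypeR R).
  apply: measurable_minr => //; apply: measurable_funM => //.
  by apply: measurable_funM => //; apply: measurableT_comp => //; exact: mmu.
have term0 n (l : 'I_q * 'I_p) v : 0 <= Num.min (g ^+ n * (`|mu 0 v l.2 0| / w l.2)) L.
  by rewrite le_min L0 andbT mulr_ge0 ?exprn_ge0 ?(ltW g0) // divr_ge0 // ltW.
pose h n v : \bar R :=
  (\sum_(l : 'I_q * 'I_p) Num.min (g ^+ n * (`|mu 0 v l.2 0| / w l.2)) L)%:E.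
have mh n : measurable_fun setT (h n).
  by apply/measurable_EFinP; apply: measurable_sum => l; exact: mterm.
have hc : {ae P, forall v, setT v -> h n v @[n --> \oo] --> cst 0%E v}.
  apply: aeW => v _; apply: cvg_EFin; first exact: nearW.
  rewrite [X in _ --> X](_ : _ = \sum_(l : 'I_q * 'I_p) (0 : R)); last by rewrite big1.
  apply: (@cvg_big R _ +%R 0 xpredT) => [|l _]; first exact: add_continuous.
  apply: (@squeeze_cvgr _ _ _ _ (cst 0) (fun n => g ^+ n * (`|mu 0 v l.2 0| / w l.2))).
  + by apply: nearW => n; rewrite term0 /= ge_min lexx.
  + exact: cvg_cst.
  + rewrite (_ : (fun n => _) = geometric (`|mu 0 v l.2 0| / w l.2) g); last first.
      by apply/funext => n; rewrite /= mulrC.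
    by apply: cvg_geometric; rewrite gtr0_norm.
have ig : P.-integrable setT (cst (\sum_(l : 'I_q * 'I_p) L)%:E).
  exact: finite_measure_integrable_cst.
have hb : {ae P, forall v n, setT v -> (`|h n v| <= cst (\sum_(l : 'I_q * 'I_p) L)%:E v)%E}.
  apply: aeW => v n _; rewrite lee_fin ger0_norm ?sumr_ge0 //.
  by apply: ler_sum => l _; rewrite ge_min lexx orbT.
have [_ _] := dominated_convergence measurableT mh (measurable_cst _) hc ig hb.
by rewrite integral0.
Qed.

(** Iterate back [n] steps, truncate at [L], let [n] tend to infinity, then [L]. The bound on the
    discounted input depends neither on [n] nor on [L]. *)
Lemma solution_L1 : exists2 K, 0 <= K & forall t i,
  (\int[P]_v (`|mu t v i 0|)%:E <= (K * w i)%:E)%E.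
Proof.
have [g g01 cg] := geometric_rate q c01; have /andP[g0 g1] := g01.
have [C C0 TC] := discounted_input_mean g01.
exists C => // t i.
have mab t' k : measurable_fun setT (fun v => `|mu t' v k 0| / w k : measurableTypeR R).
  by apply: measurable_funM => //; apply: measurableT_comp => //; exact: mmu.
have trunc L : 0 <= L -> (\int[P]_v (Num.min (`|mu t v i 0| / w i) L)%:E <= C%:E)%E.
  move=> L0.
  pose h n v : R := \sum_(l : 'I_q * 'I_p) Num.min (g ^+ n * (`|mu 0 v l.2 0| / w l.2)) L.
  have bound n : (\int[P]_v (Num.min (`|mu t v i 0| / w i) L)%:E
      <= \int[P]_v (h n v)%:E + C%:E)%E.
    pose f (l : 'I_q * 'I_p) v : \bar R :=
      (Num.min (g ^+ n * (`|mu (t - n%:Z - l.1%:Z) v l.2 0| / w l.2)) L)%:E.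
    pose f0 (l : 'I_q * 'I_p) (x : nat * measurableTypeR R) : \bar R :=
      (Num.min (g ^+ n * (`|x.2| / w l.2)) L)%:E.
    have nn (x : R) (l : 'I_q * 'I_p) : 0 <= Num.min (g ^+ n * (`|x| / w l.2)) L.
      by rewrite le_min L0 andbT mulr_ge0 ?exprn_ge0 ?(ltW g0) // divr_ge0 // ltW.
    have mf0 l : measurable_fun setT (f0 l).
      apply/measurable_EFinP; apply: measurable_minr => //; apply: measurable_funM => //.
      apply: measurable_funM => //; apply: measurableT_comp => //; exact: measurable_snd.
    have mf l : measurable_fun setT (f l).
      apply/measurable_EFinP; apply: measurable_minr => //.
      by apply: measurable_funM => //; exact: mab.
    have ff l v : (0 <= f l v)%E by rewrite lee_fin.
    have [mT IT] := TC n t.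
    have T0 v : (0 <= (discounted_input B b w g (y v) n t)%:E)%E.
      by rewrite lee_fin discounted_input_ge0.
    apply: (@le_trans _ _ (\int[P]_v (\sum_l f l v + (discounted_input B b w g (y v) n t)%:E))%E).
      apply: ae_ge0_le_integral => //.
      - move=> v _; rewrite lee_fin le_min L0 andbT divr_ge0 // ltW //.
      - by apply/measurable_EFinP; apply: measurable_minr => //; exact: mab.
      - by move=> v _; rewrite adde_ge0 // sume_ge0.
      - by apply: emeasurable_funD => //; exact: emeasurable_sum.
      - have [sol _ _ _] := reg.
        apply: filterS (ae_forall_int sol) => v solv _.
        have uE s : mu s v = regression A B b (fun s => mu s v) (y v) s by have [] := solv s.
        have := lag_iterate w0 g01 cg Gw uE n t i q0.
        rewrite expr0 mul1r subr0 -ler_pdivrMr // => it.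
        rewrite /f sumEFin -EFinD lee_fin.
        apply: (@le_trans _ _ (Num.min (g ^+ n * lag_norm q w (fun s => mu s v) (t - n%:Z) +
            discounted_input B b w g (y v) n t) L)).
          by rewrite le_min !ge_min it lexx orbT.
        apply: le_trans (ge0_minD _ _ L0) _.
        - by rewrite mulr_ge0 ?lag_norm_ge0 // exprn_ge0 // ltW.
        - exact: discounted_input_ge0.
        apply: lerD; last by rewrite ge_min lexx.
        rewrite /lag_norm mulr_sumr; apply: ge0_min_sum => // l.
        by rewrite mulr_ge0 ?exprn_ge0 ?(ltW g0) // divr_ge0 // ltW.
    rewrite ge0_integralD //; last 2 first.
    - by move=> v _; rewrite sume_ge0.
    - exact: emeasurable_sum.
    apply: leeD => //.
    rewrite ge0_integral_sum // /h; under [X in (_ <= X)%E]eq_integral do rewrite -sumEFin.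
    rewrite ge0_integral_sum //; first last.
    - by move=> l v _; rewrite lee_fin.
    - move=> l; apply/measurable_EFinP; apply: measurable_minr => //.
      by apply: measurable_funM => //; exact: mab.
    apply: lee_sum => l _.
    (* Stationarity moves the initial state from time [t - n] to time 0, so that only the discount
       depends on [n]. *)
    have := stationary_integral hN reg (t - n%:Z - l.1%:Z) l.2 (mf0 l).
    by rewrite /f0 /joint /= => -> // x; rewrite lee_fin.
  have lim0 : (\int[P]_v (h n v)%:E + C%:E)%E @[n --> \oo] --> (0 + C%:E)%E.
    by apply: cvgeD => //; [exact: truncated_lags_cvg|exact: cvg_cst].
  rewrite -[leRHS]add0e -(cvg_lim _ lim0) //; apply: lime_ge; last exact: nearW.
  by apply/cvg_ex; exists (0 + C%:E)%E.
have mmin L : measurable_fun setT (fun v => (Num.min (`|mu t v i 0| / w i) L)%:E).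
  by apply/measurable_EFinP; apply: measurable_minr => //; exact: mab.
have IC : (\int[P]_v (`|mu t v i 0| / w i)%:E <= C%:E)%E.
  have E1 v : ((`|mu t v i 0| / w i)%:E =
      limn_einf (fun n : nat => (Num.min (`|mu t v i 0| / w i) n%:R)%:E))%E.
    apply/esym; apply: (cvg_limn_einf_sup _).1; apply: cvg_near_cst.
    near=> n; congr EFin; apply/min_idPl; near: n; exact: nbhs_infty_ger.
  under eq_integral do rewrite E1.
  apply: le_trans (fatou P measurableT (fun n => mmin n%:R) _) _.
    by move=> n v _; rewrite lee_fin le_min ler0n andbT divr_ge0 // ltW.
  rewrite limn_einf_lim; apply: lime_le; first exact: is_cvg_einfs.
  apply: nearW => n; apply: le_trans (trunc n%:R (ler0n _ _)).
  by apply: ereal_inf_lbound; exists n => /=.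
have E2 v : (`|mu t v i 0|)%:E = ((w i)%:E * (`|mu t v i 0| / w i)%:E)%E.
  by rewrite -EFinM mulrC divfK // gt_eqF.
under eq_integral do rewrite E2.
rewrite ge0_integralZl_EFin //; last 3 first.
- by move=> v _; rewrite lee_fin divr_ge0 // ltW.
- by apply/measurable_EFinP; exact: mab.
- exact: ltW.
by rewrite mulrC EFinM; apply: lee_wpmul2l => //; rewrite lee_fin ltW.
Unshelve. all: by end_near. Qed.

End solution_L1.

(** * Moments and existence *)

Lemma growth_exp (R : realType) (c D eps : R) : 0 < c < 1 -> 0 < eps ->
  exists2 C, 0 <= C & forall v, 0 <= v -> expR (D + c * v) <= eps * expR v + C.
Proof.
(* Above [v0] one has [D + c v <= ln eps + v]; below it the left side is at most its value at
   [v0]. *)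
move=> /andP[c0 c1] e0; pose v0 := (D - ln eps) / (1 - c).
exists (expR (D + c * v0)); first exact: expR_ge0.
move=> v _; have c1' : 0 < 1 - c by rewrite subr_gt0.
have [vv|vv] := leP v0 v.
  apply: (@le_trans _ _ (eps * expR v)); last by rewrite lerDl expR_ge0.
  rewrite -[X in _ <= X * _]lnK ?posrE // -expRD ler_expR.
  by move: vv; rewrite ler_pdivrMr // => vv; nra.
apply: (@le_trans _ _ (expR (D + c * v0))); last by rewrite lerDr mulr_ge0 ?expR_ge0 // ltW.
by rewrite ler_expR lerD2l ler_wpM2l ?(ltW c0) // ltW.
Qed.

Lemma growth_exp_exp (R : realType) (c D eps : R) : 0 < c < 1 -> 0 < eps ->
  exists2 C, 0 <= C & forall v, 0 <= v ->
    expR (expR (D + c * v)) <= eps * expR (expR v / 8) + C.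
Proof.
move=> /andP[c0 c1] e0.
(* Above [v0], the first bound gives [expR (D + c v) <= expR v / 16], half of the available
   [expR v / 8]; by the second, the other half absorbs [- ln eps]. *)
pose v0 := Num.max ((D + ln 16) / (1 - c)) (- 16 * ln eps).
exists (expR (expR (D + c * v0))); first exact: expR_ge0.
move=> v _; have c1' : 0 < 1 - c by rewrite subr_gt0.
have [vv|vv] := leP v0 v.
  apply: (@le_trans _ _ (eps * expR (expR v / 8))); last by rewrite lerDl expR_ge0.
  rewrite -[X in _ <= X * _]lnK ?posrE // -expRD ler_expR.
  move: vv; rewrite ge_max => /andP[v1 v2].
  have h1 : expR (D + c * v) <= expR v / 16.
    rewrite -[X in _ <= _ / X]lnK ?posrE // -expRN -expRD ler_expR.
    by move: v1; rewrite ler_pdivrMr // => v1; nra.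
  have h2 : 1 + v <= expR v by exact: expR_ge1Dx.
  lra.
apply: (@le_trans _ _ (expR (expR (D + c * v0)))).
  by rewrite !ler_expR lerD2l ler_wpM2l ?(ltW c0) // ltW.
by rewrite lerDr mulr_ge0 ?expR_ge0 // ltW.
Qed.

Section solution.
Context (R : realType) d (T : measurableType d) (P : probability T R) (p q : nat).
Variables (A B : 'I_q -> 'M[R]_p) (b : 'cV[R]_p).
Variable N : int -> 'I_p -> {nonneg R} -> T -> nat.
Hypothesis hN : iid_poisson P N.
Hypothesis q0 : (0 < q)%N.
Variables (w : 'I_p -> R) (c : R).
Hypothesis w01 : forall i, 0 < w i <= 1.
Hypothesis c01 : 0 < c < 1.
Hypothesis Gw : forall i,
  \sum_(l : 'I_q * 'I_p) (`|A l.1 i l.2| + `|B l.1 i l.2|) * w l.2 <= c * w i.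

Let w0 i : 0 < w i. Proof. by case/andP: (w01 i). Qed.

Lemma regular_unique Y mu Y' mu' :
  regular_solution P A B b N Y mu -> regular_solution P A B b N Y' mu' ->
  forall t, {ae P, forall v, Y' t v = Y t v /\ mu' t v = mu t v}.
Proof.
move=> reg reg'.
pose U := predictor A B b Y mu; pose U' := predictor A B b Y' mu'.
have pU : predictable N U by exact: predictor_predictable reg.
have pU' : predictable N U' by exact: predictor_predictable reg'.
have ae := solution_ae reg; have ae' := solution_ae reg'.
have mU t i : measurable_fun setT (fun v => U v t i 0 : measurableTypeR R).
  exact: (predictable_measurable hN t i pU).
have mU' t i : measurable_fun setT (fun v => U' v t i 0 : measurableTypeR R).
  exact: (predictable_measurable hN t i pU').
have [K K0 LK] := solution_L1 hN q0 w0 c01 Gw reg.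
have [K' K'0 LK'] := solution_L1 hN q0 w0 c01 Gw reg'.
have mabs (f : T -> measurableTypeR R) : measurable_fun setT f ->
    measurable_fun setT (fun v => (`|f v|)%:E).
  by move=> mf; apply/measurable_EFinP; exact: measurableT_comp.
have mmu t i := intensity_measurable hN reg t i.
have mmu' t i := intensity_measurable hN reg' t i.
(* The left side does not involve [n]: both predictors are almost surely fixed points, so the same
   distance is contracted again and again. *)
have dist n t i : (\int[P]_v (`|U v t i 0 - U' v t i 0|)%:E
    <= (c ^+ n * (K + K') * w i)%:E)%E.
  elim: n t i => [|n IH] t i.
    apply: (@le_trans _ _ (\int[P]_v ((`|mu t v i 0|)%:E + (`|mu' t v i 0|)%:E))%E).
      apply: ae_ge0_le_integral => //.
      - exact: measurable_dist.
      - by move=> v _; rewrite -EFinD lee_fin addr_ge0.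
      - by apply: emeasurable_funD; exact: mabs.
      - apply: filterS2 ae ae' => v aev aev' _.
        have [-> _ _] := aev t; have [-> _ _] := aev' t.
        by rewrite -EFinD lee_fin; exact: ler_normB.
    rewrite ge0_integralD //; [|exact: mabs|exact: mabs].
    by rewrite expr0 mul1r mulrDl EFinD; exact: leeD.
  have h := step_contraction b hN w0 Gw pU pU' IH t i.
  rewrite exprS -[c * _ * _]mulrA; apply: le_trans h.
  have mS := predictable_measurable hN t i (step_predictable A B b hN pU).
  have mS' := predictable_measurable hN t i (step_predictable A B b hN pU').
  apply: ae_ge0_le_integral => //.
  - exact: measurable_dist.
  - exact: measurable_dist.
  - apply: filterS2 ae ae' => v aev aev' _.
    have [_ _ e1] := aev t; have [_ _ e2] := aev' t.
    by rewrite {1}/U {1}/U' e1 e2.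
move=> t.
have eqs : {ae P, forall v, forall s : int, forall i, U v s i 0 = U' v s i 0}.
  apply: ae_forall_int => s; apply: filter_forall => i.
  have h n : (\int[P]_v (`|U v s i 0 - U' v s i 0|)%:E <= ((K + K') * w i * c ^+ n)%:E)%E.
    by apply: le_trans (dist n s i) _; rewrite lee_fin -mulrA mulrC.
  have mD : measurable_fun setT (fun v => U v s i 0 - U' v s i 0 : measurableTypeR R).
    by apply: measurable_funB; [exact: mU|exact: mU'].
  apply: filterS (ae_eq0_geometric c01 mD h) => v /eqP.
  by rewrite subr_eq0 => /eqP.
apply: filterS3 ae ae' eqs => v aev aev' eqv.
have UU : U v = U' v by apply/funext => s; apply/colP => i.
have [-> -> _] := aev t; have [-> -> _] := aev' t.
by rewrite -/U -/U' UU.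
Qed.

Let pic n v := picard A B b (path_of N v) n.
Let lim v := limit_of A B b (path_of N v).

Lemma picard_exp_moment : exists2 K, 0 <= K & forall n t i,
  (\int[P]_v (expR (`|pic n v t i 0| / w i))%:E <= K%:E)%E.
Proof.
(* The factor [expR (w k)^-1] pays for the unit window; summing over [k] makes the constant uniform
   in the coordinate. *)
pose C1 := \sum_k moment_const (w k)^-1 * expR (w k)^-1.
have mc0 (r : R) : 0 <= moment_const r by exact: expR_ge0.
have C10 : 0 <= C1 by apply: sumr_ge0 => k _; rewrite mulr_ge0 // expR_ge0.
apply: (@picard_moment _ _ _ P _ _ A B b N hN w c w0 Gw expR expR _ _ _ _ _ _ C1) => //.
- by move=> x y _; rewrite ler_expR.
- by move=> D eps _; exact: growth_exp.
move=> t k x x' /andP[xx' x'1].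
have wk0 : 0 < (w k)^-1 by rewrite invr_gt0.
under eq_integral do rewrite mulrC.
apply: le_trans (log1_at_exp_moment (hN.2 t k) x' wk0) _.
rewrite lee_fin; apply: (@le_trans _ _ (moment_const (w k)^-1 * expR (w k)^-1 * expR (`|x| / w k))).
  rewrite -mulrA; apply: ler_wpM2l => //; rewrite -expRD ler_expR.
  rewrite [`|x| / _]mulrC -[X in _ <= X + _]mulr1 -mulrDr ler_wpM2l ?(ltW wk0) //.
  rewrite ge_max; apply/andP; split; last by rewrite addr_ge0.
  by have := ler_norm x; lra.
apply: ler_wpM2r; first exact: expR_ge0.
rewrite /C1 (bigD1 k) //= lerDl sumr_ge0 // => j _.
by rewrite mulr_ge0 // expR_ge0.
Qed.

Let mpic n t i : measurable_fun setT (fun v => pic n v t i 0 : measurableTypeR R).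
Proof. exact: (predictable_measurable hN t i (picard_predictable A B b hN n)). Qed.

Let mscaled (f : T -> measurableTypeR R) i : measurable_fun setT f ->
  measurable_fun setT (fun v => (expR (`|f v| / w i))%:E).
Proof.
move=> mf; apply/measurable_EFinP; apply: measurableT_comp => //.
by apply: measurable_funM => //; exact: measurableT_comp.
Qed.

Lemma picard_L1 : exists2 K, 0 <= K & forall n t i,
  (\int[P]_v (`|pic n v t i 0|)%:E <= (K * w i)%:E)%E.
Proof.
have [K K0 picK] := picard_exp_moment; exists K => // n t i.
apply: (@le_trans _ _ (\int[P]_v ((w i)%:E * (expR (`|pic n v t i 0| / w i))%:E))%E).
  apply: ge0_le_integral => //.
  - by apply/measurable_EFinP; apply: measurableT_comp => //; exact: mpic.
  - by apply: measurable_funeM; apply: mscaled; exact: mpic.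
  - move=> v _; rewrite -EFinM lee_fin mulrC -ler_pdivrMr //.
    by apply: le_trans (expR_ge1Dx _); rewrite lerDr.
rewrite ge0_integralZl_EFin ?(ltW (w0 i)) //; last by apply: mscaled; exact: mpic.
by rewrite mulrC EFinM; apply: lee_wpmul2l => //; rewrite lee_fin ltW.
Qed.

(** The conditional mean of a count is the exponential of its log-intensity, and [w i <= 1] puts it
    under [expR (|mu| / w i)]; [expR 1] comes from the unit window. *)
Lemma limit_mean_counts : exists2 K, 0 <= K & forall t i,
  (\int[P]_v ((counts (path_of N v) (lim v) t i 0)%:R)%:E <= K%:E)%E.
Proof.
have [K K0 picK] := picard_exp_moment; have [K1 K10 L1] := picard_L1.
exists (expR 1 * K) => [|t i]; first by rewrite mulr_ge0 // expR_ge0.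
have pl := limit_predictable A B b hN.
have ml := predictable_measurable hN t i pl.
have limK := limit_moment hN w0 c01 Gw L1 (@continuous_expR R) (@expR_ge0 R) picK t i.
apply: (@le_trans _ _ (\int[P]_v ((expR 1)%:E * (expR (`|lim v t i 0| / w i))%:E))%E).
  under eq_integral do rewrite mxE.
  pose f (a _ : nat) : \bar R := a%:R%:E.
  apply: (freeze_innovation hN (f := f) (eps := 1) (pl t i) (pl t i)) => //.
  - by move=> a ?; rewrite /f lee_fin.
  - by apply: measurable_funeM; exact: mscaled.
  - move=> v x y /andP[_ xU] _; rewrite /f (at_exp_mean (hN.2 t i)).
    rewrite -EFinM lee_fin -expRD ler_expR; apply: le_trans xU _.
    rewrite addrC lerD2l; apply: le_trans (ler_norm _) _.
    by rewrite ler_pdivlMr // ler_piMr //; case/andP: (w01 i).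
rewrite ge0_integralZl_EFin ?expR_ge0 //; last exact: mscaled.
by rewrite EFinM; apply: lee_wpmul2l => //; rewrite lee_fin expR_ge0.
Qed.

Lemma limit_regular :
  regular_solution P A B b N (fun t v => counts (path_of N v) (lim v) t) (fun t v => lim v t).
Proof.
have [K1 K10 L1] := picard_L1.
have pl := limit_predictable A B b hN.
split.
- move=> t.
  have fixp : {ae P, forall v, forall i : 'I_p,
      lim v t i 0 = step A B b (path_of N v) (lim v) t i 0}.
    by apply: filter_forall => i; exact: (limit_fixpoint hN w0 c01 Gw K10 L1).
  apply: filterS fixp => v fixv; split.
    apply/colP => i; rewrite [LHS]mxE [RHS]mxE /at_exp /path_of.
    by congr (N t i _ v); rewrite [RHS]mxE.
  by apply/colP => i; rewrite fixv.
- exact: constructed_stationary.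
- move=> t; rewrite past_genE.
  apply: (sigma_of_sub (T := g_sigma_algebraType (past_gen N t))) => i.
  have al : adapted N t (fun v => lim v t i 0).
    by apply: predictable_adapted => //; rewrite lerDl.
  apply: measurable_fun_pair; last exact: al.
  apply: (@measurable_counts _ _ _ (g_sigma_algebraType (past_gen N t)) N) => //.
    exact: rcont_path_of hN.
  by move=> s; exact: measurable_past_gen.
- move=> t; rewrite /finite_mean unlock.
  have [K K0 YK] := limit_mean_counts.
  have mY i : measurable_fun setT
      (fun v => (counts (path_of N v) (lim v) t i 0)%:R%:E : \bar R).
    have h := measurable_counts_of hN t i pl.
    exact: (measurable_fun_nat2 (fun a _ : nat => a%:R%:E : \bar R) h h).
  have E1 v : (norm1 (real_vec (counts (path_of N v) (lim v) t)) : R)%:E =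
      (\sum_i (counts (path_of N v) (lim v) t i 0)%:R%:E)%E.
    by rewrite sumEFin; congr EFin; apply: eq_bigr => i _; rewrite mxE ger0_norm.
  under eq_integral do rewrite E1.
  rewrite ge0_integral_sum //.
  apply: (@le_lt_trans _ _ (\sum_(i < p) K%:E)%E); first by apply: lee_sum.
  by rewrite sumEFin ltry.
Qed.

End solution.

(** A mean is at most the largest term. This reduces moments of the 1-norm to single coordinates,
    whatever their dependence. *)
Lemma expR_mean_le_sum (R : realType) (p : nat) (a : 'I_p -> R) : (0 < p)%N ->
  expR (p%:R^-1 * \sum_i a i) <= \sum_i expR (a i).
Proof.
move=> p0; have [i _ imax] := @arg_maxP _ _ _ (Ordinal p0) predT a isT.
apply: (@le_trans _ _ (expR (a i))); last first.
  by rewrite (bigD1 i) //= lerDl sumr_ge0 // => j _; exact: expR_ge0.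
rewrite ler_expR mulrC ler_pdivrMr ?ltr0n //.
apply: (@le_trans _ _ (\sum_(j < p) a i)); first by apply: ler_sum => j _; exact: imax.
by rewrite sumr_const card_ord mulr_natr.
Qed.

Section exponential_moments.
Context (R : realType) d (T : measurableType d) (P : probability T R) (p q : nat).
Variables (A B : 'I_q -> 'M[R]_p) (b : 'cV[R]_p).
Variable N : int -> 'I_p -> {nonneg R} -> T -> nat.
Hypothesis hN : iid_poisson P N.
Hypothesis p0 : (0 < p)%N.
Hypothesis q0 : (0 < q)%N.
Variable c : R.
Hypothesis c01 : 0 < c < 1.
Hypothesis Gc : forall i,
  \sum_(l : 'I_q * 'I_p) (`|A l.1 i l.2| + `|B l.1 i l.2|) <= c.

Let w (i : 'I_p) : R := 1.
Let w0 i : 0 < w i. Proof. exact: ltr01. Qed.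
Let w01 i : 0 < w i <= 1. Proof. by rewrite ltr01 lexx. Qed.
Let Gw i : \sum_(l : 'I_q * 'I_p) (`|A l.1 i l.2| + `|B l.1 i l.2|) * w l.2 <= c * w i.
Proof. by under eq_bigr do rewrite mulr1; rewrite mulr1. Qed.

Let lim v := limit_of A B b (path_of N v).

Lemma limit_expR_moment : exists2 K, 0 <= K & forall t i,
  (\int[P]_v (expR (expR `|lim v t i 0|))%:E <= K%:E)%E.
Proof.
have e4 := @expR1_le4 R.
have [K K0 picK] : exists2 K, 0 <= K & forall n t i,
    (\int[P]_v (expR (expR (`|picard A B b (path_of N v) n t i 0| / w i)))%:E <= K%:E)%E.
  (* With unit weights [Phi (ln (1 + n)) = expR ((1 + n) / 8)]: the 1 gives the constant
     [expR 8^-1], and the draw turns [n / 8] into [expR x' / 4 <= expR x]. *)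
  apply: (@picard_moment _ _ _ P _ _ A B b N hN w c w0 Gw
    (fun x => expR (expR x)) (fun x => expR (expR x / 8)) _ _ _ _ _ _ (expR 8^-1)) => //.
  - by move=> x y _ xy; rewrite !ler_expR.
  - by move=> x; rewrite ler_expR; have := expR_ge0 x; lra.
  - exact: measurableT_comp.
  - by apply: measurableT_comp => //; exact: measurable_funM.
  - by move=> D eps _; exact: growth_exp_exp.
  move=> t k x x' /andP[xx' x'1].
  have E1 v : (expR (expR (ln (1 + (at_exp (path_of N v t k) x')%:R) / w k) / 8))%:E =
      ((expR 8^-1)%:E * (expR (8^-1 * (at_exp (path_of N v t k) x')%:R))%:E)%E.
    rewrite -EFinM -expRD divr1 lnK; last by rewrite posrE ltr_pwDl.
    by rewrite mulrDl mul1r [_ / 8]mulrC.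
  under eq_integral do rewrite E1.
  have mL : measurable_fun setT
      (fun v => (expR (8^-1 * (at_exp (path_of N v t k) x')%:R) : R)%:E).
    have h : measurable_fun setT (fun v => at_exp (path_of N v t k) x').
      exact: (measurable_innovation hN t k).
    exact: (measurable_fun_nat2 (fun a _ : nat => (expR (8^-1 * a%:R) : R)%:E) h h).
  rewrite ge0_integralZl_EFin ?expR_ge0 //.
  rewrite EFinM; apply: lee_wpmul2l; first by rewrite lee_fin expR_ge0.
  apply: le_trans (at_exp_laplace8 (hN.2 t k) x') _; rewrite lee_fin divr1 ler_expR.
  have h1 : expR x' <= expR x * expR 1 by rewrite -expRD ler_expR.
  have h2 : expR x * expR 1 <= expR x * 4 by rewrite ler_wpM2l ?expR_ge0.
  have h3 : expR x <= expR `|x| by rewrite ler_expR ler_norm.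
  lra.
have [K1 K10 L1] := picard_L1 b hN w01 c01 Gw.
exists K => // t i.
have cee : continuous (fun x : R => expR (expR x)).
  by move=> x; apply: continuous_comp; exact: continuous_expR.
have := limit_moment hN w0 c01 Gw L1 cee (fun x => expR_ge0 _) picK t i.
by under eq_integral do rewrite divr1.
Qed.

Lemma solution_exp_moments Y mu : regular_solution P A B b N Y mu ->
  exists2 delta : R, 0 < delta &
    finite_mean P (fun v => expR (delta * norm1 (real_vec (Y 0 v)))) /\
    finite_mean P (fun v => expR (delta * intensity_norm1 (exp_vec (mu 0 v)))).
Proof.
move=> reg; have p1 : 0 < p%:R :> R by rewrite ltr0n.
have [K K0 limK] := limit_expR_moment.
have ae := regular_unique hN q0 w01 c01 Gw (limit_regular b hN w01 c01 Gw) reg 0.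
have pl := limit_predictable A B b hN.
have ml i : measurable_fun setT (fun v => lim v 0 i 0 : measurableTypeR R).
  exact: (predictable_measurable hN 0 i pl).
have mee i : measurable_fun setT (fun v => (expR (expR `|lim v 0 i 0|))%:E).
  by apply/measurable_EFinP; do 3 apply: measurableT_comp => //; exact: ml.
have mY i : measurable_fun setT (fun v => (Y 0 v i 0)%:R : measurableTypeR R).
  have h := solution_count_measurable hN reg 0 i.
  exact: (measurable_fun_nat2 (fun a _ : nat => a%:R : measurableTypeR R) h h).
have mmu i := intensity_measurable hN reg 0 i.
have mexpY i : measurable_fun setT (fun v => (expR (8^-1 * (Y 0 v i 0)%:R) : R)%:E).
  by apply/measurable_EFinP; apply: measurableT_comp => //; apply: measurable_funM => //; exact: mY.
have mexpmu i : measurable_fun setT (fun v => (expR (8^-1 * expR (mu 0 v i 0)))%:E).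
  apply/measurable_EFinP; apply: measurableT_comp => //; apply: measurable_funM => //.
  by apply: measurableT_comp => //; exact: mmu.
have e4 := @expR1_le4 R.
have intY i : (\int[P]_v (expR (8^-1 * (Y 0 v i 0)%:R))%:E <= K%:E)%E.
  apply: le_trans (limK 0 i).
  apply: (@le_trans _ _ (\int[P]_v (expR (8^-1 * (counts (path_of N v) (lim v) 0 i 0)%:R))%:E)%E).
    have mc := measurable_counts_of hN 0 i pl.
    apply: ae_ge0_le_integral => //.
    - exact: (measurable_fun_nat2 (fun a _ : nat => (expR (8^-1 * a%:R) : R)%:E) mc mc).
    - by apply: filterS ae => v [e _] _; rewrite e.
  under [X in (X <= _)%E]eq_integral do rewrite mxE.
  pose f (a _ : nat) : \bar R := (expR (8^-1 * a%:R))%:E.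
  apply: (freeze_innovation hN (f := f) (eps := 1) (pl 0 i) (pl 0 i)) => //.
  - by move=> a ?; rewrite /f lee_fin expR_ge0.
  - move=> v x y /andP[_ xU] _; rewrite /f.
    apply: le_trans (at_exp_laplace8 (hN.2 0 i) x) _; rewrite lee_fin ler_expR.
    have h1 : expR x <= expR (lim v 0 i 0) * expR 1 by rewrite -expRD ler_expR.
    have h2 : expR (lim v 0 i 0) * expR 1 <= expR (lim v 0 i 0) * 4.
      by rewrite ler_wpM2l ?expR_ge0.
    have h3 : expR (lim v 0 i 0) <= expR `|lim v 0 i 0| by rewrite ler_expR ler_norm.
    lra.
have intmu i : (\int[P]_v (expR (8^-1 * expR (mu 0 v i 0)))%:E <= K%:E)%E.
  apply: le_trans (limK 0 i); apply: ae_ge0_le_integral => //.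
  - apply: filterS ae => v [_ e] _; rewrite e lee_fin ler_expR.
    have : expR (lim v 0 i 0) <= expR `|lim v 0 i 0| by rewrite ler_expR ler_norm.
    by have := expR_gt0 (lim v 0 i 0); rewrite /lim; lra.
(* [1/8] is the rate available for each coordinate, and [1/p] turns the norm into a mean of
   coordinates. *)
exists (p%:R^-1 * 8^-1); first by rewrite mulr_gt0 // invr_gt0.
have fin (f : T -> R) (a : 'I_p -> T -> measurableTypeR R) :
    (forall v, f v = p%:R^-1 * \sum_i a i v) ->
    (forall i, measurable_fun setT (a i)) ->
    (forall i, (\int[P]_v (expR (a i v))%:E <= K%:E)%E) ->
    finite_mean P (fun v => expR (f v)).
  move=> fE ma aK; rewrite /finite_mean unlock.
  have mea i : measurable_fun setT (fun v => (expR (a i v))%:E).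
    by apply/measurable_EFinP; apply: measurableT_comp => //; exact: ma.
  have mf : measurable_fun setT (fun v => (expR (f v))%:E).
    under eq_fun do rewrite fE.
    apply/measurable_EFinP; apply: measurableT_comp => //.
    by apply: measurable_funM => //; apply: measurable_sum => i; exact: ma.
  have ea0 i v : (0 <= (expR (a i v))%:E)%E by rewrite lee_fin expR_ge0.
  apply: (@le_lt_trans _ _ (\int[P]_v \sum_i (expR (a i v))%:E)%E).
    apply: ge0_le_integral => //.
    - exact: emeasurable_sum.
    - by move=> v _; rewrite sumEFin lee_fin fE; exact: expR_mean_le_sum.
  rewrite ge0_integral_sum //.
  apply: (@le_lt_trans _ _ (\sum_(i < p) K%:E)%E); first by apply: lee_sum.
  by rewrite sumEFin ltry.
split.
  apply: (fin _ (fun i v => 8^-1 * (Y 0 v i 0)%:R)) => // [v|i]; last first.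
    by apply: measurable_funM => //; exact: mY.
  rewrite -mulrA /norm1 mulr_sumr; congr (_ * _); apply: eq_bigr => i _.
  by rewrite mxE ger0_norm.
apply: (fin _ (fun i v => 8^-1 * expR (mu 0 v i 0))) => // [v|i]; last first.
  by apply: measurable_funM => //; apply: measurableT_comp => //; exact: mmu.
rewrite -mulrA /intensity_norm1 /norm1 mulr_sumr; congr (_ * _); apply: eq_bigr => i _.
by rewrite !mxE /= ger0_norm // expR_ge0.
Qed.

End exponential_moments.

Theorem theorem5 (R : realType) (disp : measure_display)
    (T : measurableType disp) (P : probability T R)
    (p q : nat) (hp : (1 <= p)%N) (hq : (1 <= q)%N)
    (A B : 'I_q -> 'M[R]_p) (d : 'cV[R]_p)
    (N : int -> 'I_p -> {nonneg R} -> T -> nat) (hN : iid_poisson P N) :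
  (spectral_radius (\sum_(i < q) (abs_mx (A i) + abs_mx (B i))) < 1 ->
    exists (Y : int -> T -> 'cV[nat]_p) (mu : int -> T -> 'cV[R]_p),
      regular_solution P A B d N Y mu /\
      (forall (Y' : int -> T -> 'cV[nat]_p) (mu' : int -> T -> 'cV[R]_p),
        regular_solution P A B d N Y' mu' ->
        forall t : int, {ae P, forall w, Y' t w = Y t w /\ mu' t w = mu t w}))
  /\
  (mx_norm_inf (\sum_(i < q) (abs_mx (A i) + abs_mx (B i))) < 1 ->
    forall (Y : int -> T -> 'cV[nat]_p) (mu : int -> T -> 'cV[R]_p),
      regular_solution P A B d N Y mu ->
      exists2 delta : R, 0 < delta &
        finite_mean P (fun w => expR (delta * norm1 (real_vec (Y 0 w)))) /\
        finite_mean P (fun w =>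
          expR (delta * intensity_norm1 (exp_vec (mu 0 w))))).
Proof.
set G := \sum_(i < q) _.
have G0 i j : 0 <= G i j by rewrite summxE sumr_ge0 // => l _; rewrite !mxE addr_ge0.
split=> [rG|nG Y mu reg].
  have [w [c [c01 w01 Gw]]] := contraction_weights G0 rG.
  have Gw' i : \sum_(l : 'I_q * 'I_p) (`|A l.1 i l.2| + `|B l.1 i l.2|) * w l.2 <= c * w i.
    by rewrite -weights_lags; exact: Gw.
  exists (fun t v => counts (path_of N v) (limit_of A B d (path_of N v)) t).
  exists (fun t v => limit_of A B d (path_of N v) t).
  have reg := limit_regular d hN w01 c01 Gw'.
  by split => // Y' mu' reg'; exact: (regular_unique hN hq w01 c01 Gw' reg reg').
(* The norm may vanish, while the contraction rate must be positive. *)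
pose c := Num.max 2^-1 (mx_norm_inf G).
have c01 : 0 < c < 1.
  by rewrite lt_max invr_gt0 ltr0n /= gt_max nG invf_lt1 ?ltr1n.
apply: (solution_exp_moments hN hp hq c01 _ reg) => i.
apply: (@le_trans _ _ (mx_norm_inf G)); last by rewrite le_max lexx orbT.
have := weights_lags A B (fun=> 1) i; rewrite -/G.
under [X in _ = X -> _]eq_bigr do rewrite mulr1.
move=> <-; under eq_bigr do rewrite mulr1 -[G _ _]ger0_norm //.
exact: (le_bigmax 0 (fun i => \sum_(j < p) `|G i j|)).
Qed.
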